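(* Let $p$ be an odd prime and write $p-1=2^n z$ with $z$ odd. Let $g\in\mathcal{G}_S$ and $m'\in\mathcal{R}^{(n)}\setminus\mathcal{R}^{(n-1)}$ be such that $g^z m'^{2z}=1$ in $\mathbb{F}_p^*$. Let $L=\mathrm{logd}_2(1,z)$. Then there exists a set $A$ of $\frac{\varphi\left(\frac{p-1}{2}\right)}{L}$ primes, odd and coprime to $z$, such that $$\mathcal{G}_S=\left\{g^{2^x a}\,m'^{(2^{x+1}-2)a} : (a,x)\in(\{1\}\cup A)\times\{0,\dots,L-1\}\right\},$$ and moreover: if $p\equiv 3\ [4]$, then $\mathcal{G}_Z=\left\{g^{2^x a}\,m'^{(2^{x+1}-1)a} : (a,x)\in(\{1\}\cup A)\times\{0,\dots,L-1\}\right\}$; if $p\equiv 1\ [4]$, then $\mathcal{G}_Z=\left\{\pm g^{2^x a}\,m'^{(2^{x+1}-1)a} : (a,x)\in(\{1\}\cup A)\times\{0,\dots,L-1\}\right\}$.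
   Context: $\mathbb{F}_p^*=(\mathbb{Z}/p\mathbb{Z})^\times$; $\varphi$ is Euler's totient. $\mathcal{G}_Z$ is the set of primitive roots modulo $p$ (generators of $\mathbb{F}_p^*$). $\mathcal{G}_S$ is the set of semi-primitive roots modulo $p$, i.e. squares in $\mathbb{F}_p^*$ of primitive roots. The sets $\mathcal{R}^{(k)}\subset\mathbb{F}_p^*$ are defined recursively by $\mathcal{R}^{(0)}=\{1\}$ and $\mathcal{R}^{(k+1)}=\{x\in\mathbb{F}_p^* : x^2\in\mathcal{R}^{(k)}\}$. $\mathrm{logd}_2(1,z)$ is the multiplicative order of $2$ modulo $z$, i.e. the smallest positive integer $k$ such that $2^k\equiv 1\ [z]$. *)

(* Defs.v *)
From mathcomp Require Import all_boot all_order all_algebra all_fingroup all_solvable.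

Set Implicit Arguments.
Unset Strict Implicit.
Unset Printing Implicit Defensive.

Import GRing.Theory.
Local Open Scope ring_scope.

(* ['F_p] is the field with p elements only when p is prime.  The subsets of
   F_p^* below are represented as subsets of ['F_p] consisting of units, so
   that signs and powers are those of the field. *)

Definition primitive_roots (p : nat) : {set 'F_p} :=
  [set val u | u : {unit 'F_p} & generator [set: {unit 'F_p}] u].

Definition semi_primitive_roots (p : nat) : {set 'F_p} :=
  [set x ^+ 2 | x in primitive_roots p].

Fixpoint iter_sqrt1 (p k : nat) : {set 'F_p} :=
  if k is k'.+1
  then [set x : 'F_p | (x \is a GRing.unit) && (x ^+ 2 \in iter_sqrt1 p k')]
  else [set 1].

(* A relation rather than a function of z: for even z no such k exists. For
   z = 1 it gives k = 1. *)
Definition is_logd2_1 (z k : nat) : Prop :=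
  [/\ (0 < k)%N, (2 ^ k = 1 %[mod z])%N
    & forall j : nat, (0 < j)%N -> (2 ^ j = 1 %[mod z])%N -> (k <= j)%N].

(* Main.v *)
Require Import Defs.
From mathcomp Require Import all_boot all_order all_algebra all_fingroup all_solvable.
From mathcomp Require Import all_field all_character.
From mathcomp Require Import complex reals Rstruct ring lra zify.
From Stdlib Require Rpower Rdefinitions.

Set Implicit Arguments.
Unset Strict Implicit.
Unset Printing Implicit Defensive.

Import Order.TTheory GRing.Theory Num.Theory.
Local Open Scope ring_scope.
Local Open Scope complex_scope.

Local Notation R := Rdefinitions.R.
Local Notation C := (complex R).

(** Put G = g m'^2 and t = m'^-1. Then g = G t^2, and the relation g^z m'^(2z)
    = 1 says that G^z = 1; hence G has order z and t has order 2^n, the group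
    F_p^* is the product of <G> and <t>, and the families of the theorem
    become G^(2^x a) t^(2a) for the semi-primitive roots and G^(2^x a) t^a, up
    to sign, for the primitive ones.

    The semi-primitive roots are the powers g^i = G^i t^(2i) with i prime to M
    = (p - 1)/2 = 2^(n-1) z, and such a power depends only on i mod z and i
    mod 2^(n-1). Doubling the residue mod z while keeping the residue mod
    2^(n-1) permutes the units mod M, and all its orbits have size L, the
    order of 2 mod z. So there are phi(M)/L orbits; it suffices to have a
    prime in each of them except the one of 1, which is represented by 1
    itself, and one more large prime gives A the required size
    (prime_representatives). A primitive root is G^i t^i with i odd and prime
    to z; if a represents the orbit of i, then t^i and t^a have the same
    square, so t^i is t^a or - t^a. For n = 1 the sign is + because t has
    order 2 and both exponents are odd; for n > 1 one has -1 = t^(2^(n-1)),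
    and adding this even exponent to an odd one leaves it odd, so both signs
    give primitive roots.

    That every orbit contains a prime rests on Dirichlet's theorem on primes
    in arithmetic progressions (dirichlet_primes), proved here by the
    elementary method of Mertens and Shapiro, with finite sums only. Let
    Lambda be the von Mangoldt function and chi a nontrivial character mod m.
    All sums of chi over intervals are bounded, so the partial sums P(y) of
    the series of chi(n)/n satisfy |P(x) - P(y)| <= K/(y+1) for y <= x. Their
    limit L(1, chi) is never formed: either |P(y)| <= K/(y+1) for all y, which
    plays the role of L(1, chi) = 0, or some P(y) is larger, and then |P|
    stays away from 0 beyond y. Let S(x) be the sum of chi(n) Lambda(n)/n for
    n <= x. In the second case S is bounded (Lmangoldt_nonvanishing), in the
    first S(x) = - log x + O(1) (Lmangoldt_vanishing), while the trivial
    character gives log x + O(1) (coprime_mertens_le, coprime_mertens_ge).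

    Summing over all characters mod m gives a nonnegative multiple of the sum
    of Lambda(n)/n over n = 1 mod m, so at most one character vanishes; as the
    conjugate of a vanishing character vanishes too, such a character is real.
    But a real character does not vanish (real_char_nonvanishing): its divisor
    sums are nonnegative, and at least 1 at the squares, so that their sum
    against a tent function has order N^9, whereas vanishing would bound it by
    O(N^8). Hence S is bounded for every nontrivial character, and
    orthogonality of characters shows that the sum of Lambda(n)/n over n = c
    mod m is unbounded for c prime to m. Proper prime powers contribute at
    most 2 to it (sum_nonprime_mangoldt_le), so some prime is congruent to c. *)

(** * The logarithm of an integer *)

Definition lg (n : nat) : R := Rpower.ln n%:R.

(** The one analytic fact about the logarithm: it yields the bound 1/n on the
    increments of lg, and everything below about lg follows from this bound
    together with additivity and monotonicity. *)
Lemma ln_le_sub1 (y : R) : 0 < y -> Rpower.ln y <= y - 1.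
Proof.
move=> /RltP y0; have /RleP := Rpower.exp_ineq1_le (Rpower.ln y).
rewrite Rpower.exp_ln // RplusE R1E => h; lra.
Qed.

Lemma lg1 : lg 1 = 0.
Proof. exact: Rpower.ln_1. Qed.

Lemma lgM m n : (0 < m)%N -> (0 < n)%N -> lg (m * n) = lg m + lg n.
Proof.
move=> m0 n0; rewrite /lg natrM -RmultE Rpower.ln_mult //; apply/RltP;
  by rewrite ltr0n.
Qed.

Lemma lgS_le n : (0 < n)%N -> lg n.+1 <= lg n + n%:R^-1.
Proof.
move=> n0; have n0R : (0 : R) < n%:R by rewrite ltr0n.
have -> : lg n.+1 = lg n + Rpower.ln (1 + n%:R^-1).
  rewrite /lg -RplusE -Rpower.ln_mult; first 1 last.
  - exact/RltP.
  - by apply/RltP; rewrite addr_gt0 ?invr_gt0.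
  by congr Rpower.ln; rewrite RmultE -natr1; field; rewrite gt_eqF.
rewrite lerD2l; apply: le_trans (ln_le_sub1 _) _; last by lra.
by rewrite addr_gt0 ?invr_gt0.
Qed.

Lemma le_lg m n : (0 < m)%N -> (m <= n)%N -> lg m <= lg n.
Proof.
move=> m0; rewrite leq_eqVlt => /orP[/eqP-> //|mn]; apply: ltW.
apply/RltP; apply: Rpower.ln_increasing; apply/RltP; rewrite ?ltr0n //.
by rewrite ltr_nat.
Qed.

Lemma lg_ge0 n : (0 < n)%N -> 0 <= lg n.
Proof. by move=> n0; rewrite -lg1 le_lg. Qed.

Lemma lg_le n : (0 < n)%N -> lg n <= n%:R - 1.
Proof. by move=> n0; apply: ln_le_sub1; rewrite ltr0n. Qed.

Lemma lgX n k : (0 < n)%N -> lg (n ^ k) = k%:R * lg n.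
Proof.
move=> n0; elim: k => [|k IH]; first by rewrite expn0 lg1 mul0r.
by rewrite expnS lgM ?expn_gt0 ?n0 // IH -natr1; ring.
Qed.

Lemma lg_unbounded (c : R) : exists N, forall n, (N <= n)%N -> c < lg n.
Proof.
have lg2_gt0 : 0 < lg 2.
  rewrite -lg1; apply/RltP/Rpower.ln_increasing; apply/RltP; first exact: ltr01.
  by rewrite ltr_nat.
have := Num.Theory.archi_boundP (normr_ge0 (c / lg 2)).
set k := Num.bound _ => hk; exists (2 ^ k)%N => n hn.
apply: lt_le_trans (le_lg _ hn); last by rewrite expn_gt0.
rewrite lgX // -ltr_pdivrMr //; exact: le_lt_trans (ler_norm _) hk.
Qed.

(** * The complex modulus and summation by parts *)

(** The modulus as an element of R: the norm of R[i] takes values in R[i],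
    whose order is partial, and the estimates need a totally ordered field. *)
Definition nrm : C -> R := @Normc.normc R.

Lemma nrm0 : nrm 0 = 0.
Proof. exact: Normc.normc0. Qed.

Lemma nrmM z w : nrm (z * w) = nrm z * nrm w.
Proof. exact: Normc.normcM. Qed.

Lemma nrmD z w : nrm (z + w) <= nrm z + nrm w.
Proof. exact: le_normcD. Qed.

Lemma nrmN z : nrm (- z) = nrm z.
Proof. exact: normcN. Qed.

Lemma nrmB z w : nrm (z - w) <= nrm z + nrm w.
Proof. by rewrite -[nrm w]nrmN nrmD. Qed.

Lemma nrm_ge0 z : 0 <= nrm z.
Proof. by case: z => a b; rewrite /nrm /= sqrtr_ge0. Qed.

Lemma nrmC (x : R) : nrm x%:C = `|x|.
Proof. by rewrite /nrm /= expr0n addr0 sqrtr_sqr. Qed.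

Lemma nrm_pos (x : R) : 0 <= x -> nrm x%:C = x.
Proof. by rewrite nrmC => /ger0_norm. Qed.

Lemma nrm_sum (I : Type) (r : seq I) (P : pred I) (F : I -> C) :
  nrm (\sum_(i <- r | P i) F i) <= \sum_(i <- r | P i) nrm (F i).
Proof.
elim/big_rec2: _ => [|i a b _ IH]; first by rewrite nrm0.
by apply: le_trans (nrmD _ _) _; rewrite lerD2l.
Qed.

Lemma nrm_le_sum (I : eqType) (r : seq I) (P : pred I) (F : I -> C) (G : I -> R) :
  (forall i, i \in r -> P i -> nrm (F i) <= G i) ->
  nrm (\sum_(i <- r | P i) F i) <= \sum_(i <- r | P i) G i.
Proof.
move=> h; apply: le_trans (nrm_sum _ _ _) _.
by rewrite big_seq_cond [leRHS]big_seq_cond; apply: ler_sum => i /andP[]; apply: h.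
Qed.

(** Summation by parts. With U(c) the sum of u over [a, c), the quantity
    sum_(a <= n < b) u(n) f(n) - U(b) f(b) telescopes into terms U(n+1) (f(n)
    - f(n+1)), each at most K times a nonnegative decrement of f. *)
Lemma abel_bound (u : nat -> C) (f : nat -> R) (a b : nat) (K : R) :
  (a <= b)%N ->
  (forall c, nrm (\sum_(a <= n < c) u n) <= K) ->
  (forall n, (a <= n)%N -> f n.+1 <= f n) ->
  (forall n, (a <= n)%N -> 0 <= f n) ->
  nrm (\sum_(a <= n < b) u n * (f n)%:C) <= K * f a.
Proof.
move=> ab uK f_dec f_ge0; have K0 : 0 <= K := le_trans (nrm_ge0 _) (uK a).
pose U c := \sum_(a <= n < c) u n.
suff H : nrm (\sum_(a <= n < b) u n * (f n)%:C - U b * (f b)%:C) <= K * (f a - f b).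
  rewrite -[X in nrm X](subrK (U b * (f b)%:C)); apply: le_trans (nrmD _ _) _.
  have : nrm (U b * (f b)%:C) <= K * f b.
    by rewrite nrmM nrm_pos ?f_ge0 // ler_wpM2r ?f_ge0 ?uK.
  by move: H; lra.
elim: b ab => [|b IH].
  by rewrite leqn0 => /eqP a0; rewrite a0 /U !big_nil mul0r !subrr nrm0 mulr0.
rewrite leq_eqVlt => /orP[/eqP<-|]; first by rewrite /U !big_geq // mul0r !subrr nrm0 mulr0.
rewrite ltnS => ab; have {IH} := IH ab.
rewrite /U !big_nat_recr //= -/(U b) => IH.
have -> : \sum_(a <= i < b) u i * (f i)%:C + u b * (f b)%:C - (U b + u b) * (f b.+1)%:C
  = (\sum_(a <= i < b) u i * (f i)%:C - U b * (f b)%:C)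
    + (U b + u b) * (f b - f b.+1)%:C.
  by rewrite rmorphB /=; ring.
apply: le_trans (nrmD _ _) _; rewrite nrmM nrm_pos ?subr_ge0 ?f_dec //.
have : nrm (U b + u b) * (f b - f b.+1) <= K * (f b - f b.+1).
  by apply: ler_wpM2r; rewrite ?subr_ge0 ?f_dec //; move: (uK b.+1); rewrite big_nat_recr.
by move: IH; lra.
Qed.

(** * Sums over divisors *)

Lemma sum_multiples (V : nmodType) (d x : nat) (G : nat -> V) : (0 < d)%N ->
  \sum_(1 <= n < x.+1 | (d %| n)%N) G (n %/ d)%N = \sum_(1 <= e < (x %/ d).+1) G e.
Proof.
move=> d0; elim: x => [|x IH]; first by rewrite div0n !big_geq.
rewrite big_mkcond big_nat_recr //= -big_mkcond /= IH divnS //.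
case: ifP => h; last by rewrite addr0 add0n.
by rewrite h !add1n [RHS]big_nat_recr.
Qed.

Lemma sum_divisors (V : nmodType) (F : nat -> V) (n x : nat) :
  (0 < n)%N -> (n <= x)%N ->
  \sum_(d <- divisors n) F d = \sum_(1 <= d < x.+1 | (d %| n)%N) F d.
Proof.
move=> n0 nx; rewrite -[RHS]big_filter; apply: perm_big; apply: uniq_perm.
- exact: divisors_uniq.
- by rewrite filter_uniq ?iota_uniq.
move=> d; rewrite mem_filter mem_index_iota -dvdn_divisors // ltnS.
case: (boolP (d %| n)%N) => // dn.
by rewrite (dvdn_gt0 n0 dn) (leq_trans (dvdn_leq n0 dn)).
Qed.

(** Both sides run over the pairs (d, e) with d e <= x. This is how every
    Dirichlet convolution below is summed. *)
Lemma hyperbola (V : nmodType) (F : nat -> nat -> V) (x : nat) :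
  \sum_(1 <= n < x.+1) \sum_(d <- divisors n) F d (n %/ d)%N
  = \sum_(1 <= d < x.+1) \sum_(1 <= e < (x %/ d).+1) F d e.
Proof.
transitivity (\sum_(1 <= n < x.+1) \sum_(1 <= d < x.+1 | (d %| n)%N) F d (n %/ d)%N).
  by rewrite !big_seq; apply: eq_bigr => n; rewrite mem_index_iota => /andP[n0 nx];
    apply: (sum_divisors (fun d => F d (n %/ d)%N)).
rewrite (exchange_big_dep xpredT) //= !big_seq; apply: eq_bigr => d.
by rewrite mem_index_iota => /andP[d0 _]; rewrite (sum_multiples _ (F d)).
Qed.

(** A divisor of p^k m with p not dividing m is uniquely p^j e with j <= k and
    e dividing m. With coprime_part_ind this replaces the theory of
    multiplicative functions. *)
Lemma sum_divisors_pM (V : nmodType) (F : nat -> V) (p k m : nat) :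
  prime p -> (0 < m)%N -> ~~ (p %| m)%N ->
  \sum_(d <- divisors (p ^ k * m)) F d
  = \sum_(0 <= j < k.+1) \sum_(e <- divisors m) F (p ^ j * e)%N.
Proof.
move=> pp m0 pm; have p0 := prime_gt0 pp.
have lgn e j : (e %| m)%N -> logn p (p ^ j * e) = j.
  move=> em; have e0 := dvdn_gt0 m0 em.
  have pe : ~~ (p %| e)%N by apply: contra pm => /dvdn_trans; apply.
  by rewrite lognM ?expn_gt0 ?p0 // pfactorK // lognE pp e0 (negbTE pe) addn0.
transitivity (\sum_(d <- [seq (p ^ j * e)%N | j <- iota 0 k.+1, e <- divisors m]) F d);
  last by rewrite big_allpairs_dep /index_iota subn0.
apply: perm_big; apply: uniq_perm; first exact: divisors_uniq.
  apply: allpairs_uniq; rewrite ?iota_uniq ?divisors_uniq // => -[j e] [j' e'].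
  case/allpairsP=> -[a b] [_ hb [-> ->]].
  case/allpairsP=> -[a' b'] [_ hb' [-> ->]] /= h; rewrite /= in hb hb'.
  rewrite -!dvdn_divisors // in hb hb'.
  have aa : a = a' by rewrite -(lgn b a) // h lgn.
  move: h; rewrite aa => /eqP; rewrite eqn_mul2l expn_eq0 -leqn0 leqNgt p0 /=.
  by move/eqP->.
move=> d; rewrite -dvdn_divisors ?muln_gt0 ?expn_gt0 ?p0 //; apply/idP/allpairsP.
  move=> dn; have d0 : (0 < d)%N by rewrite (dvdn_gt0 _ dn) ?muln_gt0 ?expn_gt0 ?p0.
  have [q qp dE] := pfactor_coprime pp d0.
  have qm : (q %| m)%N.
    rewrite -(@Gauss_dvdr _ (p ^ k)) ?coprimeXr 1?coprime_sym //.
    by apply: dvdn_trans dn; rewrite dE dvdn_mulr.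
  exists (logn p d, q); split; [|by rewrite -dvdn_divisors|by rewrite mulnC].
  rewrite mem_iota add0n ltnS; have /= := dvdn_leq_log p _ dn.
  by rewrite lgn // => -> //; rewrite muln_gt0 expn_gt0 p0.
move=> [[j e] []]; rewrite mem_iota add0n ltnS -dvdn_divisors //= => jk em ->.
by rewrite dvdn_mul // dvdn_exp2l.
Qed.

Lemma coprime_part_ind (P : nat -> Prop) :
  P 1%N ->
  (forall p k m, prime p -> (0 < k)%N -> (0 < m)%N -> ~~ (p %| m)%N ->
     P m -> P (p ^ k * m)%N) ->
  forall n, (0 < n)%N -> P n.
Proof.
move=> P1 PM n; have [N] := ubnP n; elim: N n => // N IH n nN n0.
have [n1|n1] := leqP n 1; first by have -> : n = 1%N by lia.
have pp := pdiv_prime n1; have [m pm nE] := pfactor_coprime pp n0.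
have k0 : (0 < logn (pdiv n) n)%N by rewrite logn_gt0 mem_primes pp n0 pdiv_dvd.
have m0 : (0 < m)%N by move: n0; rewrite {1}nE muln_gt0 => /andP[].
rewrite nE mulnC; apply: PM => //; first by rewrite -prime_coprime.
apply: IH => //; apply: leq_trans (_ : n <= N)%N; last by [].
rewrite {1}nE ltn_Pmulr // -{1}(expn0 (pdiv n)) ltn_exp2l //; exact: prime_gt1.
Qed.

Lemma primes_pM p k m : prime p -> (0 < k)%N -> (0 < m)%N -> ~~ (p %| m)%N ->
  perm_eq (primes (p ^ k * m)) (p :: primes m).
Proof.
move=> pp k0 m0 pm; apply: uniq_perm; rewrite ?primes_uniq //=.
  by rewrite primes_uniq mem_primes (negbTE pm) !andbF.
move=> q; rewrite primesM ?expn_gt0 ?(prime_gt0 pp) // primesX // primes_prime //.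
by rewrite !inE.
Qed.

(** * The von Mangoldt function and the estimates of Chebyshev and Mertens *)

(** The value is lg p also at the powers p^k with k > 1, because primes (p^k)
    is [:: p]. *)
Definition mangoldt (n : nat) : R := if primes n is [:: p] then lg p else 0.

Lemma mangoldt_ge0 n : 0 <= mangoldt n.
Proof.
rewrite /mangoldt; case E: (primes n) => [|p [|q s]] //.
apply/lg_ge0/prime_gt0; have : p \in primes n by rewrite E inE.
by rewrite mem_primes => /andP[].
Qed.

Lemma mangoldt1 : mangoldt 1 = 0. Proof. by []. Qed.

Lemma mangoldtX p k : prime p -> (0 < k)%N -> mangoldt (p ^ k) = lg p.
Proof. by move=> pp k0; rewrite /mangoldt primesX // primes_prime. Qed.

Lemma mangoldt_prime p : prime p -> mangoldt p = lg p.
Proof. by move=> pp; rewrite -{1}[p]expn1 mangoldtX. Qed.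

Lemma mangoldt_neq0 n : mangoldt n != 0 ->
  exists p k, [/\ prime p, (0 < k)%N & n = (p ^ k)%N].
Proof.
rewrite /mangoldt; case E: (primes n) => [|p [|q s]]; rewrite ?eqxx // => _.
have : p \in primes n by rewrite E inE.
rewrite mem_primes => /and3P[pp n0 pn]; have [m pm nE] := pfactor_coprime pp n0.
have k0 : (0 < logn p n)%N by rewrite logn_gt0 mem_primes pp n0.
exists p, (logn p n); split=> //; rewrite {1}nE.
suff -> : m = 1%N by rewrite mul1n.
apply/eqP; rewrite eqn_leq; apply/andP; split; last first.
  by move: n0; rewrite nE muln_gt0 => /andP[].
rewrite leqNgt; apply/negP => m1; have qp := pdiv_prime m1.
have : pdiv m \in primes n.
  by rewrite mem_primes qp n0 nE dvdn_mulr ?pdiv_dvd.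
rewrite E inE => /eqP h; move: pm; rewrite prime_coprime // -h pdiv_dvd //.
Qed.

(** In n = p^k m the new divisors p^j e with j > 0 contribute only for e = 1,
    and then lg p each, which makes k lg p in total. *)
Lemma sum_mangoldt_divisors n : (0 < n)%N ->
  \sum_(d <- divisors n) mangoldt d = lg n.
Proof.
elim/coprime_part_ind: n / => [|p k m pp k0 m0 pm IH].
  by rewrite big_seq1 mangoldt1 lg1.
rewrite sum_divisors_pM // big_nat_recl //.
have -> : \sum_(e <- divisors m) mangoldt (p ^ 0 * e) = lg m.
  by rewrite -IH; apply: eq_bigr => e _; rewrite mul1n.
rewrite addrC lgM ?expn_gt0 ?(prime_gt0 pp) // lgX ?(prime_gt0 pp) //.
congr (_ + _).
transitivity (\sum_(0 <= j < k) lg p); last by rewrite sumr_const_nat subn0 mulr_natl.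
apply: eq_bigr => j _; rewrite (big_rem 1%N) ?divisor1 //= muln1 mangoldtX //.
rewrite big_seq big1 ?addr0 // => e; rewrite mem_rem_uniq ?divisors_uniq // inE.
rewrite -dvdn_divisors // => /andP[e1 em].
have e0 := dvdn_gt0 m0 em.
have pe : ~~ (p %| e)%N by apply: contra pm => /dvdn_trans; apply.
have /perm_size := primes_pM pp (ltn0Sn j) e0 pe.
rewrite /mangoldt; case: (primes (p ^ j.+1 * e)) => [|a [|b s]] //= [].
have e2 : (1 < e)%N by rewrite ltn_neqAle eq_sym e1.
have : pdiv e \in primes e by rewrite mem_primes pdiv_prime // e0 pdiv_dvd.
by case: (primes e).
Qed.

Definition lgfact x : R := \sum_(1 <= n < x.+1) lg n.
Definition psi x : R := \sum_(1 <= n < x.+1) mangoldt n.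

Lemma lgfactE x : lgfact x = \sum_(1 <= d < x.+1) mangoldt d * (x %/ d)%:R.
Proof.
have H : lgfact x = \sum_(1 <= n < x.+1) \sum_(d <- divisors n) mangoldt d.
  rewrite /lgfact !big_seq; apply: eq_bigr => n; rewrite mem_index_iota => /andP[n0 _].
  by rewrite sum_mangoldt_divisors.
rewrite H (hyperbola (fun d e => mangoldt d)); apply: eq_bigr => d _.
by rewrite sumr_const_nat subn1 mulr_natr.
Qed.

Lemma lgfact_le x : (0 < x)%N -> lgfact x <= x%:R * lg x.
Proof.
move=> x0; have -> : x%:R * lg x = \sum_(1 <= n < x.+1) lg x.
  by rewrite sumr_const_nat subn1 mulr_natl.
rewrite /lgfact !big_seq; apply: ler_sum => n; rewrite mem_index_iota => /andP[n0].
by rewrite ltnS; apply: le_lg.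
Qed.

Lemma sum_lg_sub_le x : (0 < x)%N -> \sum_(1 <= n < x.+1) (lg x - lg n) <= x%:R.
Proof.
case: x => // x _; elim: x => [|x IH]; first by rewrite big_nat1 lg1 subrr.
rewrite big_nat_recr //= subrr addr0.
have := @lgS_le x.+1 isT; move: IH.
rewrite !sumrB !sumr_const_nat subn1 /= -[lg x.+1 *+ _]mulr_natl -[lg x.+2 *+ _]mulr_natl.
set l := lg x.+1; set l' := lg x.+2; set s := \sum_(_ <= _ < _) _ => h1 h2.
have x0 : (0 : R) < x.+1%:R by rewrite ltr0n.
have : x.+1%:R * l' <= x.+1%:R * l + 1.
  rewrite -(ler_pM2l x0) mulrDr divff ?gt_eqF // in h2; exact: h2.
by rewrite -[x.+2%:R]natr1; move: h1; lra.
Qed.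

Lemma lgfact_ge x : (0 < x)%N -> x%:R * lg x - x%:R <= lgfact x.
Proof.
by move=> x0; have := sum_lg_sub_le x0; rewrite sumrB sumr_const_nat subn1 /= -[lg x *+ _]mulr_natl /lgfact; lra.
Qed.

Lemma sum_nat_shrink (V : nmodType) (F : nat -> V) (h x : nat) : (h <= x)%N ->
  (forall n, (h < n)%N -> F n = 0) ->
  \sum_(1 <= n < x.+1) F n = \sum_(1 <= n < h.+1) F n.
Proof.
move=> hx F0; rewrite (@big_cat_nat _ _ _ h.+1 1 x.+1) //=.
rewrite [X in (_ + X)%R](_ : _ = 0) ?addr0 // big_seq big1 // => n.
by rewrite mem_index_iota => /andP[/F0].
Qed.

(** Chebyshev's argument: in lgfact x - 2 lgfact (x/2) the coefficient of
    Lambda(n) is floor(x/n) - 2 floor(h/n) with h = x/2, which is nonnegative,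
    and at least 1 for h < n <= x; on the other hand the x lg x terms nearly
    cancel. *)
Lemma psi_half x : (1 < x)%N -> psi x - psi x./2 <= 8%:R * (x./2)%:R.
Proof.
move=> x1; set h := x./2; have h0 : (0 < h)%N by rewrite /h; lia.
have hx : (h <= x)%N by rewrite /h; lia.
have xh : (x <= 2 * h + 1)%N by rewrite /h; lia.
have H1 : psi x - psi h <= lgfact x - 2%:R * lgfact h.
  have -> : psi h = \sum_(1 <= n < x.+1) mangoldt n * (n <= h)%:R.
    rewrite (sum_nat_shrink hx) => [|n hn]; last by rewrite leqNgt hn mulr0.
    rewrite /psi !big_seq; apply: eq_bigr => n; rewrite mem_index_iota ltnS => /andP[_ ->].
    by rewrite mulr1.
  have -> : lgfact h = \sum_(1 <= n < x.+1) mangoldt n * (h %/ n)%:R.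
    by rewrite lgfactE (sum_nat_shrink hx) // => n hn; rewrite divn_small ?mulr0.
  rewrite lgfactE /psi mulr_sumr -!sumrB !big_seq; apply: ler_sum => n.
  rewrite mem_index_iota ltnS => /andP[n0 nx].
  have -> : mangoldt n - mangoldt n * (n <= h)%:R = mangoldt n * (1 - (n <= h)%:R) by ring.
  have -> : mangoldt n * (x %/ n)%:R - 2%:R * (mangoldt n * (h %/ n)%:R)
    = mangoldt n * ((x %/ n)%:R - 2%:R * (h %/ n)%:R) by ring.
  apply: ler_wpM2l; first exact: mangoldt_ge0.
  suff H : (1 + 2 * (h %/ n) <= x %/ n + (n <= h))%N.
    by move: H; rewrite -(ler_nat R) natrD natrM natrD; lra.
  case: (leqP n h) => nh.
    rewrite addn1 add1n ltnS leq_divRL //; have := leq_trunc_div h n; rewrite /h; lia.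
  by rewrite [(h %/ n)%N]divn_small // muln0 !addn0 leq_divRL // mul1n.
apply: le_trans H1 _.
have Hx := @lgfact_le x (ltnW x1); have Hh := lgfact_ge h0.
have L3 : lg x <= lg h + 2%:R.
  have : lg x <= lg (3 * h) by apply: le_lg; lia.
  by rewrite lgM //; have := @lg_le 3 isT; rewrite -[3%:R](natr1 2); lra.
have L4 : lg x <= 2%:R * h%:R.
  apply: le_trans (lg_le (ltnW x1)) _; rewrite lerBlDr -natrM -[1]/(1%:R) -natrD ler_nat; lia.
have : x%:R * lg x <= (2%:R * h%:R + 1) * lg x.
  apply: ler_wpM2r; first by rewrite lg_ge0 // ltnW.
  by rewrite -natrM -[1]/(1%:R) -natrD ler_nat.
have : h%:R * lg x <= h%:R * (lg h + 2%:R) by apply: ler_wpM2l.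
by move: Hx Hh L4; lra.
Qed.

Lemma psi_le x : psi x <= 8%:R * x%:R.
Proof.
have [N] := ubnP x; elim: N x => // N IH x xN.
have [x1|x1] := leqP x 1.
  have -> : psi x = 0 by case: x x1 xN => [|[|x]] // _ _; rewrite /psi ?big_nat1 // big_geq.
  exact: mulr_ge0 (ler0n _ _) (ler0n _ _).
have /IH h : (x./2 < N)%N by lia.
have := psi_half x1; have : (x./2)%:R + (x./2)%:R <= x%:R :> R.
  by rewrite -natrD ler_nat; lia.
by move: h; lra.
Qed.

Definition mertens x : R := \sum_(1 <= n < x.+1) mangoldt n / n%:R.

(** From x/n <= floor(x/n) + 1 the sum x (mertens x) is at most lgfact x + psi
    x. *)
Lemma mertens_le x : (0 < x)%N -> mertens x <= lg x + 8%:R.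
Proof.
move=> x0; have x0R : (0 : R) < x%:R by rewrite ltr0n.
rewrite -(ler_pM2l x0R) mulrDr.
have : x%:R * mertens x <= lgfact x + psi x.
  rewrite lgfactE /psi /mertens mulr_sumr -big_split /= !big_seq; apply: ler_sum => n.
  rewrite mem_index_iota => /andP[n0 _]; have n0R : (0 : R) < n%:R by rewrite ltr0n.
  rewrite -[X in _ + X]mulr1 -mulrDr mulrCA; apply: ler_wpM2l; first exact: mangoldt_ge0.
  rewrite ler_pdivrMr // -[1]/(1%:R) -natrD -natrM ler_nat addn1 ltnW //.
  by rewrite ltn_ceil.
have := lgfact_le x0; have := psi_le x; lra.
Qed.

(** Here floor(x/n) <= x/n gives lgfact x <= x (mertens x). *)
Lemma mertens_ge x : (0 < x)%N -> lg x - 1 <= mertens x.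
Proof.
move=> x0; have x0R : (0 : R) < x%:R by rewrite ltr0n.
rewrite -(ler_pM2l x0R) mulrBr mulr1.
apply: le_trans (lgfact_ge x0) _.
rewrite lgfactE /mertens mulr_sumr !big_seq; apply: ler_sum => n.
rewrite mem_index_iota => /andP[n0 _]; have n0R : (0 : R) < n%:R by rewrite ltr0n.
rewrite mulrCA; apply: ler_wpM2l; first exact: mangoldt_ge0.
by rewrite ler_pdivlMr // -natrM ler_nat leq_trunc_div.
Qed.

(** The terms are dominated by the decrements of (lg n + 2)/n, so the sum
    telescopes. *)
Lemma sum_lg_quad_le x : \sum_(2 <= n < x.+1) lg n / (n%:R * (n%:R - 1)) <= 2%:R.
Proof.
case: x => [|x]; first by rewrite big_geq ?ler0n.
suff : \sum_(2 <= n < x.+2) lg n / (n%:R * (n%:R - 1))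
       <= 2%:R - (lg x.+1 + 2%:R) / x.+1%:R.
  move/le_trans; apply; rewrite gerBl divr_ge0 ?addr_ge0 ?lg_ge0 //.
elim: x => [|x IH]; first by rewrite big_geq // lg1; lra.
rewrite big_nat_recr //=; apply: le_trans (lerD IH (lexx _)) _.
have := @lgS_le x.+1 isT; rewrite -[x.+2%:R]natr1.
set l := lg x.+1; set l' := lg x.+2; set t := x.+1%:R => h.
have t1 : 1 <= t by rewrite /t ler1n.
have t0 : 0 < t by lra.
have -> : 2%:R - (l + 2%:R) / t + l' / ((t + 1) * (t + 1 - 1))
  = 2%:R - (l' + 2%:R) / (t + 1)
    - ((t + 1) * (l - l' + t^-1) + (1 - t^-1)) / (t * (t + 1)).
  by field; rewrite !gt_eqF //; lra.
rewrite gerBl; apply: divr_ge0; last by apply: mulr_ge0; lra.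
have ti : t^-1 <= 1 by rewrite invf_le1.
apply: addr_ge0; last by rewrite subr_ge0.
by apply: mulr_ge0; [lra | move: h; rewrite addrAC subr_ge0].
Qed.


Lemma geometric_tail_le (p : R) N : 1 < p ->
  \sum_(2 <= k < N) (p ^+ k)^-1 <= (p * (p - 1))^-1.
Proof.
move=> p1; have p0 : 0 < p by lra.
have pB : 0 < p - 1 by lra.
have [N2|N2] := leqP N 2; first by rewrite big_geq // invr_ge0 mulr_ge0 //; lra.
rewrite -(subnK (ltnW N2)); rewrite addn2; set m := (N - 2)%N.
suff -> : \sum_(2 <= k < m.+2) (p ^+ k)^-1
    = (p * (p - 1))^-1 - (p ^+ m.+1 * (p - 1))^-1.
  by rewrite gerBl invr_ge0 mulr_ge0 ?exprn_ge0 //; lra.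
elim: m => [|m IH]; first by rewrite big_geq // expr1 subrr.
rewrite big_nat_recr //= IH !exprS.
by field; rewrite ?expf_neq0 ?gt_eqF.
Qed.

Lemma term_le_sum (I : eqType) (r : seq I) (F : I -> R) i :
  i \in r -> (forall j, 0 <= F j) -> F i <= \sum_(j <- r) F j.
Proof. by move=> ir F0; rewrite (big_rem i) //= lerDl sumr_ge0. Qed.

Lemma sum_eq_le (I : eqType) (r : seq I) (F : I -> R) q : uniq r -> 0 <= F q ->
  \sum_(n <- r) (if n == q then F n else 0) <= F q.
Proof.
move=> ur Fq; case: (boolP (q \in r)) => qr; last first.
  rewrite big_seq big1 // => n nr; case: eqP => // nq; by rewrite -nq nr in qr.
rewrite (big_rem q) //= eqxx big_seq big1 ?addr0 // => n.
by rewrite mem_rem_uniq // inE => /andP[/negbTE->].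
Qed.

(** The nonprime n with Lambda(n) != 0 are the p^k with k > 1; summing lg p /
    p^k over k > 1 gives lg p / (p (p - 1)), and these are summed over all
    integers p > 1. *)
Lemma sum_nonprime_mangoldt_le x :
  \sum_(1 <= n < x.+1 | ~~ prime n) mangoldt n / n%:R <= 2%:R.
Proof.
apply: le_trans (sum_lg_quad_le x).
pose F (p k n : nat) : R := lg p / n%:R.
have F0 p k n : (0 < p)%N -> 0 <= F p k n by move=> p0; rewrite divr_ge0 ?lg_ge0.
have F0' p k n : 0 <= (if prime p then (if n == (p ^ k)%N then F p k n else 0) else 0).
  by case: ifP => // /prime_gt0 p0; case: ifP => // _; apply: F0.
apply: (@le_trans _ _ (\sum_(1 <= n < x.+1) \sum_(2 <= p < x.+1) \sum_(2 <= k < x.+1)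
   (if prime p then (if n == (p ^ k)%N then F p k n else 0) else 0))).
  rewrite big_mkcond big_seq [leRHS]big_seq; apply: ler_sum => n.
  rewrite mem_index_iota ltnS => /andP[n0 nx].
  have pos p : 0 <= \sum_(2 <= k < x.+1)
      (if prime p then (if n == (p ^ k)%N then F p k n else 0) else 0).
    by apply: sumr_ge0 => k _.
  case: ifP => np; last exact: sumr_ge0.
  have [->|L0] := eqVneq (mangoldt n) 0; first by rewrite mul0r sumr_ge0.
  have [p [k [pp k0 nE]]] := mangoldt_neq0 L0.
  have k2 : (1 < k)%N.
    rewrite ltn_neqAle k0 andbT; apply: contra np; rewrite nE => /eqP<-.
    by rewrite expn1.
  have p2 := prime_gt1 pp.
  have kx : (k <= x)%N.
    by apply: leq_trans nx; rewrite nE ltnW // ltn_expl.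
  have px : (p <= x)%N.
    by apply: leq_trans nx; rewrite nE -{1}(expn1 p) leq_exp2l.
  apply: le_trans (term_le_sum (i := p) _ pos); last by rewrite mem_index_iota; apply/andP.
  apply: le_trans (term_le_sum (i := k) _ _); last 2 first.
  - by rewrite mem_index_iota; apply/andP.
  - by move=> j; apply: F0'.
  by rewrite pp -nE eqxx /F nE mangoldtX.
rewrite exchange_big /= big_seq [leRHS]big_seq; apply: ler_sum => p.
rewrite mem_index_iota => /andP[p2 _].
have p0 : (0 < p)%N by apply: ltnW.
have p1R : (1 : R) < p%:R by rewrite ltr1n.
case: (boolP (prime p)) => pp; last first.
  rewrite big1 => [|n _]; last by rewrite big1.
  by rewrite divr_ge0 ?lg_ge0 // mulr_ge0 // subr_ge0 ltW.
rewrite exchange_big /=.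
apply: (@le_trans _ _ (\sum_(2 <= k < x.+1) lg p * (p%:R ^+ k)^-1)).
  apply: ler_sum => k _ /=; apply: le_trans (@sum_eq_le _ _ (F p k) (p ^ k)%N _ _) _; rewrite ?iota_uniq ?F0 //.
  by rewrite /F natrX.
by rewrite -mulr_sumr; apply: ler_wpM2l; rewrite ?lg_ge0 // geometric_tail_le.
Qed.

(** A prime not coprime to m divides m, hence is at most m. *)
Lemma sum_noncoprime_mangoldt_le m x : (0 < m)%N ->
  \sum_(1 <= n < x.+1 | ~~ coprime n m) mangoldt n / n%:R <= 2%:R + lgfact m.
Proof.
move=> m0.
have T n : (0 < n)%N -> 0 <= (if (n <= m)%N then lg n else 0).
  by move=> n0; case: ifP => // _; apply: lg_ge0.
apply: (@le_trans _ _ (\sum_(1 <= n < x.+1 | ~~ prime n) mangoldt n / n%:R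
   + \sum_(1 <= n < x.+1) (if (n <= m)%N then lg n else 0))).
  rewrite [X in X <= _]big_mkcond [X in _ <= X + _]big_mkcond -big_split /=.
  rewrite big_seq [leRHS]big_seq; apply: ler_sum => n.
  rewrite mem_index_iota ltnS => /andP[n0 nx].
  have L0 : 0 <= mangoldt n / n%:R by rewrite divr_ge0 ?mangoldt_ge0.
  have := T n n0; case: (boolP (prime n)) => pn h /=; last first.
    by case: ifP => _; lra.
  rewrite add0r prime_coprime // negbK; case: ifP => // nm.
  rewrite (dvdn_leq m0 nm) mangoldt_prime // ler_pdivrMr ?ltr0n //.
  by rewrite ler_peMr ?lg_ge0 // ler1n.
apply: lerD; first exact: sum_nonprime_mangoldt_le.
apply: (@le_trans _ _ (\sum_(1 <= n < (maxn x m).+1) (if (n <= m)%N then lg n else 0))).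
  rewrite [leRHS](@big_cat_nat _ _ _ x.+1) //= ?ltnS ?leq_maxl // lerDl.
  rewrite big_seq sumr_ge0 // => n; rewrite mem_index_iota => /andP[xn _].
  by apply: T; apply: leq_trans xn.
rewrite (@sum_nat_shrink _ _ m) ?leq_maxr //; last by move=> n; rewrite ltnNge => /negbTE->.
rewrite /lgfact big_seq [leRHS]big_seq; apply: ler_sum => n.
by rewrite mem_index_iota ltnS => /andP[_ ->].
Qed.

(** * Completely multiplicative functions with bounded sums *)

(** The factor at p is -1 when p divides n exactly once and 0 otherwise, so
    that the product vanishes off the squarefree integers. *)
Definition moebius (n : nat) : R :=
  \prod_(p <- primes n) (if logn p n == 1%N then -1 else 0).

Lemma moebius1 : moebius 1 = 1. Proof. by rewrite /moebius big_nil. Qed.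

Lemma moebius_le1 n : `|moebius n| <= 1.
Proof.
rewrite /moebius normr_prod; elim: (primes n) => [|p s IH]; rewrite ?big_nil // big_cons.
by case: ifP => _; rewrite ?normrN1 ?mul1r ?normr0 ?mul0r ?ler01.
Qed.

Lemma moebius_pM p j e : prime p -> (0 < e)%N -> ~~ (p %| e)%N -> (0 < j)%N ->
  moebius (p ^ j * e) = if j == 1%N then - moebius e else 0.
Proof.
move=> pp e0 pe j0; have p0 := prime_gt0 pp.
have lgpe : logn p e = 0%N by rewrite lognE pp e0 (negbTE pe).
rewrite /moebius (perm_big _ (primes_pM pp j0 e0 pe)) /= big_cons.
rewrite lognM ?expn_gt0 ?p0 // pfactorK // lgpe addn0.
case: eqP => j1; last by rewrite mul0r.
rewrite mulN1r; congr (- _); rewrite !big_seq; apply: eq_bigr => q.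
rewrite mem_primes => /and3P[qp _ qe].
rewrite lognM ?expn_gt0 ?p0 // lognX (logn_prime q pp) (_ : (q == p) = false) ?muln0 //.
by apply/negbTE; apply: contra pe => /eqP<-.
Qed.

(** Of the divisors p^j e only those with j = 0, 1 survive, and the signs at e
    and p e are opposite. *)
Lemma sum_moebius_pM (f : nat -> R) p k m : prime p -> (0 < k)%N -> (0 < m)%N ->
  ~~ (p %| m)%N ->
  \sum_(d <- divisors (p ^ k * m)) moebius d * f d
  = \sum_(e <- divisors m) moebius e * (f e - f (p * e)%N).
Proof.
move=> pp k0 m0 pm.
have div_e e : e \in divisors m -> (0 < e)%N /\ ~~ (p %| e)%N.
  rewrite -dvdn_divisors // => em; split; first exact: dvdn_gt0 em.
  by apply: contra pm => /dvdn_trans; apply.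
rewrite (sum_divisors_pM (fun d => moebius d * f d)) //.
rewrite big_nat_recl // -(prednK k0) big_nat_recl //= [X in _ + (_ + X)]big1_seq ?addr0.
  rewrite -big_split /= !big_seq; apply: eq_bigr => e /div_e[e0 pe].
  by rewrite expn0 mul1n (moebius_pM pp e0 pe (ltn0Sn 0)) expn1 /=; ring.
move=> j _; rewrite big1_seq // => e /= /div_e[e0 pe].
by rewrite moebius_pM // mul0r.
Qed.

Lemma sum_moebius n : (0 < n)%N -> \sum_(d <- divisors n) moebius d = (n == 1%N)%:R.
Proof.
elim/coprime_part_ind: n / => [|p k m pp k0 m0 pm _]; first by rewrite big_seq1 moebius1.
have := sum_moebius_pM (fun=> 1) pp k0 m0 pm.
under eq_bigr do rewrite mulr1.
move=> ->; rewrite big1 => [|e _]; last by rewrite subrr mulr0.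
rewrite muln_eq1 gtn_eqF //.
by rewrite -{1}(expn0 p) ltn_exp2l ?prime_gt1.
Qed.

(** The Moebius inverse of sum_mangoldt_divisors, obtained directly: by
    sum_moebius_pM with f = lg the sum for p^k m is - lg p times the sum of
    the Moebius function over the divisors of m, which is zero unless m = 1.
    *)
Lemma mangoldtE n : (0 < n)%N ->
  mangoldt n = - \sum_(d <- divisors n) moebius d * lg d.
Proof.
elim/coprime_part_ind: n / => [|p k m pp k0 m0 pm _].
  by rewrite big_seq1 lg1 mulr0 oppr0.
rewrite sum_moebius_pM // -sumrN.
transitivity (lg p * \sum_(e <- divisors m) moebius e).
  rewrite sum_moebius //; case: (eqVneq m 1%N) => [->|m1].
    by rewrite muln1 mangoldtX // mulr1.
  rewrite mulr0 /mangoldt; have /perm_size := primes_pM pp k0 m0 pm.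
  case: (primes (p ^ k * m)) => [|a [|b s]] //= [].
  have m2 : (1 < m)%N by rewrite ltn_neqAle eq_sym m1.
  have : pdiv m \in primes m by rewrite mem_primes pdiv_prime // m0 pdiv_dvd.
  by case: (primes m).
rewrite mulr_sumr !big_seq; apply: eq_bigr => e; rewrite -dvdn_divisors // => em.
by rewrite lgM ?(dvdn_gt0 m0 em) ?(prime_gt0 pp) //; ring.
Qed.

(** What the analysis uses of a nontrivial Dirichlet character. The bound on
    interval sums is where nontriviality enters. *)
Record bounded_char (K : R) (chi : nat -> C) : Prop := BoundedChar {
  bchar1 : chi 1%N = 1;
  bcharM : forall m n, chi (m * n)%N = chi m * chi n;
  bchar_le1 : forall n, nrm (chi n) <= 1;
  bchar_sum : forall a b, nrm (\sum_(a <= n < b) chi n) <= K }.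

Definition twist (chi : nat -> C) (n : nat) : C := chi n * (n%:R^-1)%:C.
(** A partial sum of the series for L(1, chi). *)
Definition Lpartial (chi : nat -> C) (x : nat) : C := \sum_(1 <= n < x.+1) twist chi n.
(** A partial sum of the series for - L'(1, chi) / L(1, chi), the logarithmic
    derivative. *)
Definition Lmangoldt (chi : nat -> C) (x : nat) : C :=
  \sum_(1 <= n < x.+1) twist chi n * (mangoldt n)%:C.

Section Analysis.

Variables (K : R) (chi : nat -> C) (chiP : bounded_char K chi).
Local Notation a := (twist chi).
Local Notation P := (Lpartial chi).
Local Notation S := (Lmangoldt chi).

Lemma bchar_bound_ge0 : 0 <= K.
Proof. exact: le_trans (nrm_ge0 _) (bchar_sum chiP 0 0). Qed.

Lemma twistM m n : a (m * n)%N = a m * a n.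
Proof. by rewrite /twist (bcharM chiP) natrM invfM rmorphM /=; ring. Qed.

Lemma twist_le n : nrm (a n) <= n%:R^-1.
Proof.
rewrite /twist nrmM nrm_pos ?invr_ge0 //.
by rewrite -[leRHS]mul1r ler_wpM2r ?invr_ge0 // (bchar_le1 chiP).
Qed.

(** Complete multiplicativity lets the twist by chi(n)/n pass through a
    Dirichlet convolution. *)
Lemma twist_conv (G : nat -> nat -> C) x :
  \sum_(1 <= n < x.+1) a n * \sum_(d <- divisors n) G d (n %/ d)%N
  = \sum_(1 <= d < x.+1) a d * \sum_(1 <= e < (x %/ d).+1) a e * G d e.
Proof.
rewrite -[RHS](_ : \sum_(1 <= d < x.+1) \sum_(1 <= e < (x %/ d).+1) a d * (a e * G d e) = _);
  last by apply: eq_bigr => d _; rewrite mulr_sumr.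
rewrite -(hyperbola (fun d e => a d * (a e * G d e))) !big_seq; apply: eq_bigr => n.
rewrite mem_index_iota => /andP[n0 _]; rewrite mulr_sumr !big_seq; apply: eq_bigr => d.
rewrite -dvdn_divisors // => dn; rewrite mulrA -twistM mulnC divnK //.
Qed.

(** Partial summation of chi against 1/n. This quantitative Cauchy property
    stands in for the value L(1, chi) of the series. *)
Lemma Lpartial_tail y x : (y <= x)%N -> nrm (P x - P y) <= K / y.+1%:R.
Proof.
move=> yx; rewrite /Lpartial (@big_cat_nat _ _ _ y.+1 1 x.+1) //= addrC addrK.
apply: abel_bound => // [c|n yn|n yn]; first exact: bchar_sum.
  by rewrite lef_pV2 ?posrE ?ltr0n ?ler_nat // (leq_trans _ yn).
by rewrite invr_ge0.
Qed.

Lemma Lpartial_le x : nrm (P x) <= K.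
Proof.
have := Lpartial_tail (leq0n x); rewrite {2}/Lpartial big_geq // subr0.
by rewrite divr1.
Qed.

(** Partial summation needs a decreasing weight; lg n / n first increases, but
    (lg n + 1)/n decreases from n = 1 on. *)
Lemma sum_twist_lg_le x : nrm (\sum_(1 <= n < x.+1) a n * (lg n)%:C) <= 2%:R * K.
Proof.
have -> : \sum_(1 <= n < x.+1) a n * (lg n)%:C
  = \sum_(1 <= n < x.+1) chi n * ((lg n + 1) / n%:R)%:C - P x.
  rewrite /Lpartial -sumrB; apply: eq_bigr => n _; rewrite /twist.
  by rewrite !rmorphM rmorphD rmorph1; ring.
apply: le_trans (nrmB _ _) _.
suff : nrm (\sum_(1 <= n < x.+1) chi n * ((lg n + 1) / n%:R)%:C) <= K.
  by have := Lpartial_le x; lra.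
have -> : K = K * ((lg 1 + 1) / 1%:R) by rewrite lg1 add0r divr1 mulr1.
apply: (abel_bound (f := fun n => (lg n + 1) / n%:R)) => // [c|n n0|n n0].
- exact: bchar_sum.
- have n0R : (0 : R) < n%:R by rewrite ltr0n.
  rewrite ler_pdivrMr ?ltr0n // mulrAC ler_pdivlMr // -[n.+1%:R]natr1.
  have := lgS_le n0; have := lg_ge0 n0; set l := lg n; set l' := lg n.+1 => l0 h.
  have : l' * n%:R <= (l + n%:R^-1) * n%:R by rewrite ler_pM2r.
  by rewrite (mulrDl l) mulVf ?gt_eqF //; lra.
- by rewrite divr_ge0 // addr_ge0 ?lg_ge0.
Qed.

Lemma inv_floor_le x d : (0 < x)%N -> (0 < d)%N ->
  d%:R^-1 * (x %/ d).+1%:R^-1 <= x%:R^-1 :> R.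
Proof.
move=> x0 d0; rewrite -invfM lef_pV2 ?posrE ?mulr_gt0 ?ltr0n //.
by rewrite -natrM ler_nat mulnC ltnW // ltn_ceil.
Qed.

(** Since sum_(d | n) mu(d) (lg x - lg d) equals Lambda(n), plus lg x when n =
    1, the left-hand side is a sum over d <= x of terms a(d) mu(d) (lg x - lg
    d) P(x/d). Under the hypothesis on P each is at most (K/x) (lg x - lg d),
    and these add up to at most K by sum_lg_sub_le. *)
Lemma Lmangoldt_vanishing x : (0 < x)%N -> (forall y, nrm (P y) <= K / y.+1%:R) ->
  nrm (S x + (lg x)%:C) <= K.
Proof.
move=> x0 PA; have x0R : (0 : R) < x%:R by rewrite ltr0n.
pose G (d e : nat) := (moebius d * (lg x - lg d))%:C.
have -> : S x + (lg x)%:C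
  = \sum_(1 <= n < x.+1) a n * \sum_(d <- divisors n) G d (n %/ d)%N.
  transitivity (\sum_(1 <= n < x.+1) (a n * (mangoldt n)%:C
      + (if n == 1%N then (lg x)%:C else 0))).
    rewrite big_split /=; congr (_ + _).
    rewrite big_ltn // eqxx big_seq big1 ?addr0 // => n.
    by rewrite mem_index_iota => /andP[n1 _]; rewrite gtn_eqF.
  rewrite !big_seq; apply: eq_bigr => n; rewrite mem_index_iota => /andP[n0 _].
  rewrite /G -rmorph_sum mangoldtE //.
  have -> : \sum_(d <- divisors n) moebius d * (lg x - lg d)
    = lg x * (n == 1%N)%:R - \sum_(d <- divisors n) moebius d * lg d.
    rewrite -sum_moebius // mulr_sumr -sumrB; apply: eq_bigr => d _; ring.
  rewrite rmorphB rmorphN /= mulrBr mulrN addrC; congr (_ - _).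
  case: eqP => [->|_]; last by rewrite mulr0 rmorph0 mulr0.
  by rewrite mulr1 /twist (bchar1 chiP) invr1 rmorph1 !mul1r.
rewrite (twist_conv G).
apply: (@le_trans _ _ (\sum_(1 <= d < x.+1) K / x%:R * (lg x - lg d))); last first.
  rewrite -mulr_sumr -mulrA ler_piMr ?bchar_bound_ge0 // mulrC ler_pdivrMr // mul1r.
  exact: sum_lg_sub_le.
apply: nrm_le_sum => d; rewrite mem_index_iota ltnS => /andP[d0 dx] _.
have -> : \sum_(1 <= e < (x %/ d).+1) a e * G d e = P (x %/ d) * G d 0.
  by rewrite /Lpartial mulr_suml.
have ld : 0 <= lg x - lg d by rewrite subr_ge0 le_lg.
rewrite /G nrmM (nrmM (P _)) nrmC normrM (ger0_norm ld).
rewrite !mulrA; apply: ler_wpM2r => //.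
apply: (@le_trans _ _ (nrm (a d) * nrm (P (x %/ d)))).
  by apply: ler_piMr; rewrite ?moebius_le1 ?mulr_ge0 ?nrm_ge0.
apply: (@le_trans _ _ (d%:R^-1 * (K / (x %/ d).+1%:R))).
  by apply: ler_pM; rewrite ?nrm_ge0 ?twist_le.
by rewrite mulrCA; apply: ler_wpM2l; [exact: bchar_bound_ge0 | exact: inv_floor_le].
Qed.

(** Summing a(n) lg n as a convolution of a Lambda with a gives a bounded sum
    of a(d) Lambda(d) P(x/d). Replacing P(x/d) by P(x) costs at most (K/x)
    psi(x), hence S(x) P(x) is bounded, and P(x) stays away from 0. *)
Lemma Lmangoldt_nonvanishing y : K / y.+1%:R < nrm (P y) ->
  exists B, forall x, (0 < x)%N -> (y <= x)%N -> nrm (S x) <= B.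
Proof.
move=> Py; pose dl : R := nrm (P y) - K / y.+1%:R.
have dl0 : 0 < dl by rewrite subr_gt0.
(* 2 K bounds the sum of a(n) lg n and 8 K comes from psi x <= 8 x. *)
exists (10%:R * K / dl) => x x0 yx; have x0R : (0 : R) < x%:R by rewrite ltr0n.
rewrite ler_pdivlMr //.
(* P x is within K / (y + 1) of P y. *)
have Pdl : dl <= nrm (P x).
  have := Lpartial_tail yx; have := nrmB (P x) (P x - P y).
  by rewrite subKr /dl; move: (K / _) (nrm _) (nrm _) (nrm _); clear=> p q r t; lra.
apply: (@le_trans _ _ (nrm (S x * P x))).
  by rewrite nrmM ler_wpM2l ?nrm_ge0.
have -> : S x * P x = \sum_(1 <= d < x.+1) a d * (mangoldt d)%:C * P (x %/ d)
   + \sum_(1 <= d < x.+1) a d * (mangoldt d)%:C * (P x - P (x %/ d)).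
  rewrite /Lmangoldt mulr_suml -big_split /=; apply: eq_bigr => d _.
  by rewrite -mulrDr addrC subrK.
have -> : 10%:R * K = 2%:R * K + 8%:R * K by rewrite -mulrDl -natrD.
apply: le_trans (nrmD _ _) _; apply: lerD.
  apply: le_trans (sum_twist_lg_le x); rewrite le_eqVlt; apply/orP; left; apply/eqP.
  congr nrm; transitivity (\sum_(1 <= n < x.+1) a n *
      \sum_(d <- divisors n) (mangoldt d)%:C).
    rewrite (twist_conv (fun d e => (mangoldt d)%:C)); apply: eq_bigr => d _.
    by rewrite -mulrA; congr (_ * _); rewrite mulrC /Lpartial mulr_suml.
  rewrite !big_seq; apply: eq_bigr => n; rewrite mem_index_iota => /andP[n0 _].
  by rewrite -rmorph_sum sum_mangoldt_divisors.
apply: (@le_trans _ _ (\sum_(1 <= d < x.+1) K / x%:R * mangoldt d)); last first.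
  rewrite -mulr_sumr -mulrA [leRHS]mulrC; apply: ler_wpM2l; first exact: bchar_bound_ge0.
  by rewrite mulrC ler_pdivrMr // psi_le.
apply: nrm_le_sum => d; rewrite mem_index_iota ltnS => /andP[d0 dx] _.
rewrite nrmM (nrmM (a d)) nrm_pos ?mangoldt_ge0 // mulrAC; apply: ler_wpM2r; first exact: mangoldt_ge0.
apply: (@le_trans _ _ (d%:R^-1 * (K / (x %/ d).+1%:R))).
  by apply: ler_pM; rewrite ?nrm_ge0 ?twist_le // Lpartial_tail // leq_div.
by rewrite mulrCA; apply: ler_wpM2l; [exact: bchar_bound_ge0 | exact: inv_floor_le].
Qed.

End Analysis.

(** * Real characters *)

Lemma sub_sum_le (I : eqType) (s r : seq I) (F : I -> R) :
  uniq s -> uniq r -> {subset s <= r} -> (forall i, i \in r -> 0 <= F i) ->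
  \sum_(i <- s) F i <= \sum_(i <- r) F i.
Proof.
move=> us ur sr F0; have -> : \sum_(i <- s) F i = \sum_(i <- r | i \in s) F i.
  rewrite -[RHS]big_filter; apply: perm_big; apply: uniq_perm; rewrite ?filter_uniq //.
  by move=> i; rewrite mem_filter; case: (boolP (i \in s)) => // /sr->.
rewrite [leRHS](bigID (mem s)) /= lerDl big_seq_cond sumr_ge0 // => i /andP[ir _].
exact: F0.
Qed.

Section RealChar.

Variables (K : R) (eps : nat -> R).
Hypothesis chiP : bounded_char K (fun n => (eps n)%:C).
Hypothesis eps_val : forall n, eps n \in [:: -1; 0; 1].

Lemma eps1 : eps 1 = 1.
Proof. by have /= := bchar1 chiP => -[]. Qed.

Lemma epsM m n : eps (m * n) = eps m * eps n.
Proof. by have := bcharM chiP m n; rewrite /= -rmorphM => -[]. Qed.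

Lemma epsX m k : eps (m ^ k) = eps m ^+ k.
Proof. by elim: k => [|k IH]; rewrite ?expn0 ?eps1 // expnS epsM IH exprS. Qed.

Definition divsum n : R := \sum_(d <- divisors n) eps d.

Lemma divsum_pM p k m : prime p -> (0 < m)%N -> ~~ (p %| m)%N ->
  divsum (p ^ k * m) = (\sum_(0 <= j < k.+1) eps p ^+ j) * divsum m.
Proof.
move=> pp m0 pm; rewrite /divsum (sum_divisors_pM eps) // mulr_suml.
by apply: eq_bigr => j _; rewrite mulr_sumr; apply: eq_bigr => e _; rewrite epsM epsX.
Qed.

Lemma geom_eps (e : R) k : e \in [:: -1; 0; 1] ->
  (~~ odd k)%:R <= \sum_(0 <= j < k.+1) e ^+ j.
Proof.
rewrite !inE => /or3P[]/eqP->.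
- suff -> : \sum_(0 <= j < k.+1) (-1) ^+ j = (~~ odd k)%:R :> R by [].
  elim: k => [|k IH]; first by rewrite big_nat1.
  rewrite big_nat_recr //= IH -signr_odd /=; case: (odd k) => /=; rewrite ?expr0 ?expr1; lra.
- rewrite big_nat_recl // expr0 big1 ?addr0 ?lern1 ?leq_b1 // => j _.
  by rewrite expr0n.
- under eq_bigr do rewrite expr1n.
  by rewrite sumr_const_nat subn0 ler_nat; case: (odd k).
Qed.

(** This sum is multiplicative, and at p^k it is a geometric sum with ratio
    -1, 0 or 1, hence nonnegative, and at least 1 if k is even. The same
    argument gives divsum_sqr. *)
Lemma divsum_ge0 n : (0 < n)%N -> 0 <= divsum n.
Proof.
elim/coprime_part_ind: n / => [|p k m pp k0 m0 pm IH].
  by rewrite /divsum big_seq1 eps1.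
rewrite divsum_pM // mulr_ge0 //; apply: le_trans (geom_eps _ _) => //.
Qed.

Lemma divsum_sqr n : (0 < n)%N -> 1 <= divsum (n ^ 2).
Proof.
elim/coprime_part_ind: n / => [|p k m pp k0 m0 pm IH].
  by rewrite /divsum big_seq1 eps1.
rewrite expnMn -expnM divsum_pM ?expn_gt0 ?m0 //; last by rewrite Euclid_dvdX // negb_and pm.
rewrite -[1]mulr1; apply: ler_pM => //; apply: le_trans (geom_eps _ _) => //.
by rewrite muln2 odd_double.
Qed.

(** The weight x - k on the multiples k of n tends to 0 as k approaches x, so
    that the sum depends on n more regularly than the number of these
    multiples. *)
Definition tent (x n : nat) : R := \sum_(1 <= e < (x %/ n).+1) (x%:R - (n * e)%:R).

Lemma sum_divsum_tent x :
  \sum_(1 <= k < x.+1) divsum k * (x%:R - k%:R)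
  = \sum_(1 <= n < x.+1) eps n * tent x n.
Proof.
transitivity (\sum_(1 <= k < x.+1) \sum_(d <- divisors k)
   eps d * (x%:R - (d * (k %/ d))%:R)).
  rewrite !big_seq; apply: eq_bigr => k; rewrite mem_index_iota => /andP[k0 _].
  rewrite /divsum mulr_suml !big_seq; apply: eq_bigr => d.
  by rewrite -dvdn_divisors // => dk; rewrite [(d * _)%N]mulnC divnK.
rewrite (hyperbola (fun d e => eps d * (x%:R - (d * e)%:R))).
by apply: eq_bigr => n _; rewrite mulr_sumr.
Qed.

(** The remainder r (n - r) / 2n, with r = x mod n, is at most n/2, which is
    small against x for n well below x. *)
Lemma tentE x n : (0 < n)%N ->
  tent x n = x%:R ^+ 2 / 2%:R * n%:R^-1 - x%:R / 2%:R
     + (x %% n)%:R * (n%:R - (x %% n)%:R) / (2%:R * n%:R).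
Proof.
move=> n0; have nN0 : n%:R != 0 :> R by rewrite pnatr_eq0 -lt0n.
have H J : \sum_(1 <= e < J.+1) (x%:R - (n * e)%:R) =
   J%:R * x%:R - n%:R * (J%:R * (J%:R + 1)) / 2%:R :> R.
  elim: J => [|J IH]; first by rewrite big_geq // !mul0r mulr0 mul0r subrr.
  by rewrite big_nat_recr //= IH natrM -!natr1; field.
rewrite /tent H; have := divn_eq x n; set J := (x %/ n)%N; set r := (x %% n)%N => xE.
rewrite {}xE natrD natrM; move: (J%:R : R) (r%:R : R) => j s; field.
exact: nN0.
Qed.

Lemma tent_ge0 x n : (0 < n)%N -> 0 <= tent x n.
Proof.
move=> n0; rewrite /tent big_seq sumr_ge0 // => e; rewrite mem_index_iota ltnS.
by move=> /andP[_ eJ]; rewrite subr_ge0 ler_nat mulnC -leq_divRL.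
Qed.

Lemma tent_dec x n : (0 < n)%N -> tent x n.+1 <= tent x n.
Proof.
move=> n0; have J : (x %/ n.+1 <= x %/ n)%N by apply: leq_div2l.
rewrite /tent [leRHS](@big_cat_nat _ _ _ (x %/ n.+1).+1) //= ler_wpDr //.
  rewrite big_seq sumr_ge0 // => e; rewrite mem_index_iota ltnS.
  by move=> /andP[_ eJ]; rewrite subr_ge0 ler_nat mulnC -leq_divRL.
by apply: ler_sum => e _; rewrite lerB // ler_nat leq_mul2r leqnSn orbT.
Qed.

Lemma tent_le x n : (0 < n)%N -> tent x n <= x%:R ^+ 2 / n%:R.
Proof.
move=> n0; have n0R : (0 : R) < n%:R by rewrite ltr0n.
apply: (@le_trans _ _ (\sum_(1 <= e < (x %/ n).+1) x%:R)).
  by apply: ler_sum => e _; rewrite gerBl.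
rewrite sumr_const_nat subn1 -[x%:R *+ _]mulr_natr expr2 -mulrA; apply: ler_wpM2l => //.
by rewrite ler_pdivlMr // -natrM ler_nat leq_trunc_div.
Qed.

Lemma eps_le n : `|eps n| <= 1.
Proof. by have := bchar_le1 chiP n; rewrite nrmC. Qed.

Lemma sum_eps_le a b : `|\sum_(a <= n < b) eps n| <= K.
Proof. by rewrite -nrmC rmorph_sum; apply: (bchar_sum chiP). Qed.

(** For n <= y the closed form tentE is used: the first term is controlled by
    the vanishing hypothesis, the second by the bound K on sums of eps, the
    remainder trivially. For n > y, partial summation against the decreasing
    function tent x. *)
Lemma sum_tent_le x y : (y <= x)%N ->
  (forall z, nrm (Lpartial (fun n => (eps n)%:C) z) <= K / z.+1%:R) ->
  `|\sum_(1 <= n < x.+1) eps n * tent x n|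
   <= 2%:R * K * x%:R ^+ 2 / y.+1%:R + K * x%:R + y%:R ^+ 2.
Proof.
move=> yx PA; rewrite (@big_cat_nat _ _ _ y.+1 1 x.+1) //=.
have K0 := bchar_bound_ge0 chiP.
have yS : (0 : R) < y.+1%:R by rewrite ltr0n.
have H2 : `|\sum_(y.+1 <= n < x.+1) eps n * tent x n| <= K * x%:R ^+ 2 / y.+1%:R.
  rewrite -nrmC rmorph_sum.
  under eq_bigr do rewrite rmorphM /=.
  apply: le_trans (abel_bound (f := tent x) (K := K) _ _ _ _) _ => //.
  - exact: (bchar_sum chiP).
  - by move=> n yn; rewrite tent_dec // (leq_trans _ yn).
  - by move=> n yn; rewrite tent_ge0 // (leq_trans _ yn).
  by rewrite -mulrA; apply: ler_wpM2l => //; apply: tent_le.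
have H1 : `|\sum_(1 <= n < y.+1) eps n * tent x n|
   <= x%:R ^+ 2 / 2%:R * (K / y.+1%:R) + x%:R / 2%:R * K + y%:R ^+ 2.
  have -> : \sum_(1 <= n < y.+1) eps n * tent x n =
     x%:R ^+ 2 / 2%:R * (\sum_(1 <= n < y.+1) eps n / n%:R)
     - x%:R / 2%:R * (\sum_(1 <= n < y.+1) eps n)
     + \sum_(1 <= n < y.+1)
         eps n * ((x %% n)%:R * (n%:R - (x %% n)%:R) / (2%:R * n%:R)).
    rewrite !mulr_sumr -sumrB -big_split /= !big_seq; apply: eq_bigr => n.
    rewrite mem_index_iota => /andP[n0 _]; rewrite tentE //; ring.
  apply: le_trans (ler_normD _ _) _; apply: lerD; last first.
    apply: le_trans (ler_norm_sum _ _ _) _.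
    apply: (@le_trans _ _ (\sum_(1 <= n < y.+1) y%:R)); last first.
      by rewrite sumr_const_nat subn1 -[y%:R *+ _]mulr_natr expr2.
    rewrite big_seq [leRHS]big_seq; apply: ler_sum => n.
    rewrite mem_index_iota ltnS => /andP[n0 ny].
    have n0R : (0 : R) < n%:R by rewrite ltr0n.
    have rn : (x %% n)%:R <= n%:R :> R by rewrite ler_nat ltnW // ltn_pmod.
    have r0 : (0 : R) <= (x %% n)%:R by [].
    rewrite normrM -[y%:R]mul1r; apply: ler_pM => //; first exact: eps_le.
    apply: (@le_trans _ _ n%:R); last by rewrite ler_nat.
    rewrite ger0_norm; last by rewrite divr_ge0 ?mulr_ge0 ?subr_ge0.
    rewrite ler_pdivrMr ?mulr_gt0 //; move: (x %% n)%:R rn r0 => r rn r0; nra.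
  apply: le_trans (ler_normB _ _) _; apply: lerD; rewrite normrM ger0_norm ?divr_ge0 ?exprn_ge0 //;
    apply: ler_wpM2l; rewrite ?divr_ge0 ?exprn_ge0 //; last exact: sum_eps_le.
  apply: le_trans (PA y); rewrite -nrmC rmorph_sum /Lpartial /twist.
  by under eq_bigr do rewrite rmorphM /=.
apply: le_trans (ler_normD _ _) _.
apply: le_trans (lerD H1 H2) _.
have xK : 0 <= x%:R * K by rewrite mulr_ge0.
have xK2 : 0 <= K * x%:R ^+ 2 / y.+1%:R by rewrite divr_ge0 ?mulr_ge0 ?exprn_ge0.
have -> : x%:R ^+ 2 / 2%:R * (K / y.+1%:R) = K * x%:R ^+ 2 / y.+1%:R / 2%:R by move: (y.+1%:R^-1) => Y; field.
have -> : 2%:R * K * x%:R ^+ 2 / y.+1%:R = 2%:R * (K * x%:R ^+ 2 / y.+1%:R) by rewrite !mulrA.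
move: (_ / y.+1%:R) xK2 (y%:R ^+ 2) => A A0 B; lra.
Qed.

(** Only the squares k = i^2 with i <= q are kept; there the tent is at least
    3 q^2. *)
Lemma sum_divsum_ge q :
  3%:R * q%:R ^+ 3 <= \sum_(1 <= k < (4 * q ^ 2).+1) divsum k * ((4 * q ^ 2)%:R - k%:R).
Proof.
pose s := [seq (i ^ 2)%N | i <- index_iota 1 q.+1].
apply: (@le_trans _ _ (\sum_(k <- s) divsum k * ((4 * q ^ 2)%:R - k%:R))); last first.
  apply: sub_sum_le; rewrite ?iota_uniq //.
  - rewrite map_inj_uniq ?iota_uniq // => i j /eqP; rewrite eqn_exp2r // => /eqP//.
  - move=> _ /mapP[i hi ->]; move: hi; rewrite !mem_index_iota !ltnS => /andP[i0 iq].
    rewrite expn_gt0 i0; apply: leq_trans (leq_pmull _ _) => //.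
    by rewrite leq_exp2r.
  - move=> k; rewrite mem_index_iota ltnS => /andP[k0 kx].
    by rewrite mulr_ge0 ?divsum_ge0 // subr_ge0 ler_nat.
rewrite big_map; apply: (@le_trans _ _ (\sum_(1 <= i < q.+1) 3%:R * q%:R ^+ 2)).
  by rewrite sumr_const_nat subn1 -[leRHS]mulr_natr /= exprSr mulrA.
rewrite big_seq [leRHS]big_seq; apply: ler_sum => i.
rewrite mem_index_iota ltnS => /andP[i0 iq].
have : (i ^ 2)%:R <= q%:R ^+ 2 :> R by rewrite -natrX ler_nat leq_exp2r.
have := divsum_sqr i0; rewrite natrM [(q ^ 2)%:R]natrX.
have : 0 <= q%:R ^+ 2 :> R by rewrite exprn_ge0.
move: (divsum _) ((i ^ 2)%:R : R) (q%:R ^+ 2 : R) => D I Q Q0 D1 IQ; nra.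
Qed.

(** With x = 4 N^6 the lower bound is 3 N^9. The error terms of sum_tent_le,
    namely x^2/y, x and y^2, are all O(N^8) for the choice y = N^4. *)
Lemma real_char_nonvanishing :
  ~ (forall z, nrm (Lpartial (fun n => (eps n)%:C) z) <= K / z.+1%:R).
Proof.
move=> PA; have K0 := bchar_bound_ge0 chiP.
(* Dividing the final inequality 3 N^9 <= (36 K + 1) N^8 by N^8 bounds N. *)
pose b : R := 37%:R * K + 1.
have b0 : 0 <= b by rewrite /b; lra.
have := Num.Theory.archi_boundP b0; set N := Num.bound b => bN.
have N1 : (1 : R) <= N%:R by rewrite ler1n -(ltr0n R); apply: le_lt_trans bN.
set q := (N ^ 3)%N; set x := (4 * q ^ 2)%N.
have N0 : (0 < N)%N by rewrite -(ler1n R).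
have yx : (N ^ 4 <= x)%N.
  rewrite /x /q -expnM; apply: leq_trans (leq_pmull _ _) => //.
  by rewrite leq_pexp2l.
have := sum_tent_le yx PA; rewrite -sum_divsum_tent.
have := sum_divsum_ge q; rewrite -/x => h1 h2.
have {h1 h2} := le_trans h1 (le_trans (ler_norm _) h2).
have -> : x%:R = 4%:R * N%:R ^+ 6 :> R by rewrite /x /q natrM -expnM natrX.
have -> : q%:R = N%:R ^+ 3 :> R by rewrite natrX.
set Y : R := (N ^ 4).+1%:R; rewrite [(N ^ 4)%:R]natrX.
have Yn : N%:R ^+ 4 <= Y by rewrite /Y -natrX ler_nat.
have Y0 : 0 < Y by rewrite ltr0n.
move: (N%:R : R) N1 bN Yn => n n1 bn Yn h.
have n0 : 0 < n by apply: lt_le_trans n1.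
have n8 : 0 < n ^+ 8 by rewrite exprn_gt0.
have h1 : 2%:R * K * (4%:R * n ^+ 6) ^+ 2 / Y <= 32%:R * K * n ^+ 8.
  rewrite ler_pdivrMr //.
  have -> : 2%:R * K * (4%:R * n ^+ 6) ^+ 2 = 32%:R * K * n ^+ 8 * n ^+ 4 by ring.
  by apply: ler_wpM2l => //; rewrite !mulr_ge0 // ltW.
have h2 : K * (4%:R * n ^+ 6) <= 4%:R * K * n ^+ 8.
  have -> : K * (4%:R * n ^+ 6) = 4%:R * K * n ^+ 6 by ring.
  by apply: ler_wpM2l; rewrite ?mulr_ge0 // ler_weXn2l.
have h3 : 3%:R * n * n ^+ 8 <= (36%:R * K + 1) * n ^+ 8.
  have -> : 3%:R * n * n ^+ 8 = 3%:R * (n ^+ 3) ^+ 3 by ring.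
  apply: le_trans h _.
  have -> : (n ^+ 4) ^+ 2 = n ^+ 8 by ring.
  have -> : (36%:R * K + 1) * n ^+ 8 = 32%:R * K * n ^+ 8 + 4%:R * K * n ^+ 8 + n ^+ 8 by ring.
  by rewrite lerD2r lerD.
rewrite ler_pM2r // in h3.
move: bn h3 n1; rewrite /b; lra.
Qed.

End RealChar.

(** * The dual of a finite abelian group *)

(** In characteristic 0 the polynomial X^n - 1 is separable, so it has n
    distinct roots in a closed field. *)
Lemma closed_prim_root_exists (F : numClosedFieldType) n : (0 < n)%N ->
  exists z : F, n.-primitive_root z.
Proof.
pose p : {poly F} := 'X^n - 1; have [r Dp] := closed_field_poly_normal p.
move=> n_gt0; rewrite (monicP _) ?monicXnsubC // scale1r in Dp.
have rn1 : all n.-unity_root r by apply/allP=> z; rewrite -root_prod_XsubC -Dp.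
have sz_r : (n < (size r).+1)%N.
  by rewrite -(size_prod_XsubC r id) -Dp size_XnsubC.
have [|z] := hasP (has_prim_root n_gt0 rn1 _ sz_r); last by exists z.
by rewrite -separable_prod_XsubC -Dp separable_Xn_sub_1 // pnatr_eq0 -lt0n.
Qed.

Section Dual.

Variable gT : finGroupType.

(** A character of an abelian group of order e is stored through its
    exponents: f stands for x -> zeta^(f x), with zeta a primitive e-th root
    of unity in any field. So the characters form a finite additive group, and
    they can be produced over the algebraic numbers and evaluated in R[i]. *)
Definition dual : {set {ffun gT -> 'I_#|gT|.-1.+1}} :=
  [set f : {ffun gT -> 'I_#|gT|.-1.+1}
     | [forall x : gT, [forall y : gT, f (x * y)%g == f x + f y]]].

Lemma dualP (f : {ffun gT -> 'I_#|gT|.-1.+1}) :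
  reflect (forall x y : gT, f (x * y)%g = f x + f y) (f \in dual).
Proof.
rewrite inE; apply: (iffP forallP) => [h x y|h x].
  by move/forallP: (h x) => /(_ y)/eqP.
by apply/forallP => y; apply/eqP.
Qed.

Lemma dualD f g : f \in dual -> g \in dual -> f + g \in dual.
Proof.
move=> /dualP fM /dualP gM; apply/dualP => x y; rewrite !ffunE fM gM; exact: addrACA.
Qed.

Lemma dualN f : f \in dual -> - f \in dual.
Proof. by move=> /dualP fM; apply/dualP => x y; rewrite !ffunE fM opprD. Qed.

Lemma dual0 : 0 \in dual.
Proof. by apply/dualP => x y; rewrite !ffunE addr0. Qed.

Lemma prednK_card : #|gT|.-1.+1 = #|gT|.
Proof. by rewrite prednK //; apply/card_gt0P; exists 1%g. Qed.

(** The irreducible characters over the algebraic numbers are linear, and the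
    intersection of their kernels is trivial. Their values are e-th roots of
    unity, whose exponents form an element of the dual. *)
Lemma dual_separates (a : gT) : abelian [set: gT] -> a != 1%g ->
  exists2 f, f \in dual & f a != 0.
Proof.
move=> abG a1; set G : {group gT} := [set: gT]%G.
have linG (i : Iirr G) : 'chi_i \is a linear_char by apply/char_abelianP.
have [i ia] : exists i : Iirr G, 'chi_i a != 1.
  apply/existsP; apply: contraR a1; rewrite negb_exists => /forallP h.
  have : a \in \bigcap_(i : Iirr G) cfker 'chi_i.
    apply/bigcapP => i _; rewrite cfkerEchar ?irr_char // inE inE /=.
    by rewrite lin_char1 //; have := h i; rewrite negbK.
  by rewrite TI_cfker_irr => /set1P->.
have e0 : (0 < #|gT|)%N by rewrite -prednK_card.
have [w w_prim] := closed_prim_root_exists algC e0.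
have {w_prim} wP : #|gT|.-1.+1.-primitive_root w by rewrite prednK_card.
have ex x : exists k : 'I_#|gT|.-1.+1, 'chi_i x == w ^+ k.
  have : 'chi_i x ^+ #|gT|.-1.+1 = 1.
    rewrite prednK_card -lin_charX ?inE //.
    have : (#[x]%g %| #|gT|)%N by rewrite -cardsT order_dvdG ?inE.
    by rewrite order_dvdn => /eqP->; rewrite lin_char1.
  by case/(prim_rootP wP) => k ->; exists k.
pose f : {ffun gT -> 'I_#|gT|.-1.+1} := [ffun x => xchoose (ex x)].
have fE x : 'chi_i x = w ^+ f x by rewrite ffunE; apply/eqP/(xchooseP (ex x)).
exists f.
  apply/dualP => x y; apply/val_inj/eqP; rewrite /= -(modn_small (ltn_ord (f (x * y)%g))).
  by rewrite -(eq_prim_root_expr wP) -fE lin_charM ?inE // !fE exprD.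
by apply: contra ia => /eqP fa; rewrite fE fa.
Qed.

Variable zeta : C.
Hypothesis zetaP : #|gT|.-1.+1.-primitive_root zeta.

Definition dval (f : {ffun gT -> 'I_#|gT|.-1.+1}) (x : gT) : C := zeta ^+ f x.

Lemma dvalM f x y : f \in dual -> dval f (x * y)%g = dval f x * dval f y.
Proof. by move=> /dualP fM; rewrite /dval fM /= (prim_expr_mod zetaP) exprD. Qed.

Lemma dvalD f g x : dval (f + g) x = dval f x * dval g x.
Proof. by rewrite /dval !ffunE /= (prim_expr_mod zetaP) exprD. Qed.

Lemma dval0 x : dval 0 x = 1.
Proof. by rewrite /dval ffunE. Qed.

Lemma dval_eq1 f x : (dval f x == 1) = (f x == 0).
Proof.
rewrite /dval -[1](expr0 zeta) (eq_prim_root_expr zetaP) mod0n modn_small //.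
Qed.

Lemma dval1 f : f \in dual -> dval f 1%g = 1.
Proof.
move=> /dualP fM; apply/eqP; rewrite dval_eq1; have := fM 1%g 1%g.
by rewrite mulg1 => /eqP; rewrite -subr_eq0 opprD addNKr oppr_eq0.
Qed.

Lemma nrm_dval f x : nrm (dval f x) = 1.
Proof.
have : nrm (dval f x) ^+ #|gT|.-1.+1 = 1.
  have nrmX z k : nrm (z ^+ k) = nrm z ^+ k.
    elim: k => [|k IH]; last by rewrite !exprS nrmM IH.
    by rewrite !expr0 -[1 : C]/(1%:C) nrmC normr1.
  by rewrite -nrmX /dval -exprM mulnC exprM (prim_expr_order zetaP) expr1n -[1 : C]/(1%:C) nrmC normr1.
by move/eqP; rewrite pexpr_eq1 ?nrm_ge0 // => /eqP.
Qed.

Lemma dvalN f x : dval (- f) x = (dval f x)^*.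
Proof.
have n1 : dval f x * (dval f x)^* = 1.
  by rewrite -sqr_normc -[`|_|]/((nrm (dval f x))%:C) nrm_dval expr1n.
have n2 : dval f x * dval (- f) x = 1 by rewrite -dvalD subrr dval0.
have nz : dval f x != 0.
  by apply/eqP => h; move: n1; rewrite h mul0r => /eqP; rewrite eq_sym oner_eq0.
by apply: (mulfI nz); rewrite n1 n2.
Qed.

(** If x != 1, translation by an element g of the dual with g x != 0
    multiplies the sum by a number different from 1. *)
Lemma sum_dual (x : gT) : abelian [set: gT] ->
  \sum_(f in dual) dval f x = (#|dual| * (x == 1%g))%:R.
Proof.
move=> abG; case: eqP => [->|/eqP x1].
  rewrite muln1 -sumr_const; apply: eq_bigr => f; exact: dval1.
rewrite muln0; have [g gD gx] := dual_separates abG x1.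
set s := \sum_(f in dual) _.
have : s = dval g x * s.
  rewrite {1}/s (reindex_inj (addrI g)) /= mulr_sumr.
  apply: eq_big => [f|f _]; last by rewrite dvalD.
  apply/idP/idP => fD; last exact: dualD.
  by rewrite -(addKr g f); apply: dualD => //; apply: dualN.
move/eqP; rewrite -subr_eq0 -{1}[s]mul1r -mulrBl mulf_eq0 subr_eq0 eq_sym dval_eq1.
by rewrite (negbTE gx) => /eqP.
Qed.

Lemma sum_dval f : f \in dual -> f != 0 -> \sum_x dval f x = 0.
Proof.
move=> fD f0; have [y fy] : exists y, f y != 0.
  apply/existsP; apply: contraR f0; rewrite negb_exists => /forallP h.
  by apply/eqP/ffunP => y; rewrite ffunE; apply/eqP; have := h y; rewrite negbK.
set s := \sum_x _.
have : s = dval f y * s.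
  rewrite {1}/s (reindex_inj (mulgI y)) /= mulr_sumr.
  by apply: eq_bigr => x _; rewrite dvalM.
move/eqP; rewrite -subr_eq0 -{1}[s]mul1r -mulrBl mulf_eq0 subr_eq0 eq_sym dval_eq1.
by rewrite (negbTE fy) => /eqP.
Qed.

End Dual.

(** * Dirichlet's theorem on primes in arithmetic progressions *)

Section DirichletChar.

Variable m' : nat.
Local Notation m := m'.+2.
Local Notation gT := ({unit 'Z_m} : finGroupType).
Local Notation hom := {ffun gT -> 'I_#|gT|.-1.+1}.

Variable zeta : C.
Hypothesis zetaP : #|gT|.-1.+1.-primitive_root zeta.

Lemma residue_unit n : coprime m n -> exists u : gT, n%:R = val u :> 'Z_m.
Proof. by rewrite -unitZpE // => h; exists (FinRing.unit _ h). Qed.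

Lemma residue_coprime n (u : gT) : n%:R = val u :> 'Z_m -> coprime m n.
Proof. by rewrite -unitZpE // => ->; apply: valP. Qed.

Definition dchar (f : hom) (n : nat) : C :=
  if insub (n%:R : 'Z_m) is Some u then dval zeta f (u : gT) else 0.

Lemma dchar_unit f n u : n%:R = val u :> 'Z_m -> dchar f n = dval zeta f u.
Proof. by rewrite /dchar => ->; rewrite valK. Qed.

Lemma dchar_non f n : ~~ coprime m n -> dchar f n = 0.
Proof. by move=> h; rewrite /dchar insubN // unitZpE. Qed.

Lemma dchar1 f : f \in dual gT -> dchar f 1 = 1.
Proof. by move=> fD; rewrite (@dchar_unit f 1 1%g) // (dval1 zetaP). Qed.

Lemma dcharM f a b : f \in dual gT -> dchar f (a * b) = dchar f a * dchar f b.
Proof.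
move=> fD; case: (boolP (coprime m a)) => ma; last first.
  by rewrite (dchar_non _ ma) mul0r dchar_non // coprimeMr (negbTE ma).
case: (boolP (coprime m b)) => mb; last first.
  by rewrite (dchar_non _ mb) mulr0 dchar_non // coprimeMr (negbTE mb) andbF.
have [u ua] := residue_unit ma; have [v vb] := residue_unit mb.
rewrite (dchar_unit _ ua) (dchar_unit _ vb) -(dvalM zetaP) //.
by apply: dchar_unit; rewrite natrM ua vb.
Qed.

Lemma nrm_dchar_le f n : nrm (dchar f n) <= 1.
Proof.
rewrite /dchar; case: insubP => [u _ _|_]; first by rewrite (nrm_dval zetaP).
by rewrite nrm0.
Qed.

Lemma dchar_per f n : dchar f (n + m) = dchar f n.
Proof. by rewrite /dchar natrD pchar_Zp // addr0. Qed.

Lemma sum_dchar_period f : f \in dual gT -> f != 0 -> \sum_(0 <= n < m) dchar f n = 0.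
Proof.
move=> fD f0; rewrite big_mkord.
transitivity (\sum_(x : 'Z_m) if insub x is Some u then dval zeta f (u : gT) else 0).
  by apply: eq_bigr => x _; rewrite /dchar natr_Zp.
rewrite (bigID (fun x : 'Z_m => x \is a GRing.unit)) /= [X in _ + X]big1 ?addr0; last first.
  by move=> x xu; rewrite insubN.
rewrite -[RHS](sum_dval zetaP fD f0).
rewrite (reindex_omap (val : gT -> 'Z_m) insub) /=; last first.
  by move=> x xu; rewrite insubT.
by apply: eq_big => [u|u _]; rewrite ?valK ?eqxx ?(valP u).
Qed.

(** A full period contributes 0, which leaves less than m terms. *)
Lemma dchar_sum_le f b : f \in dual gT -> f != 0 ->
  nrm (\sum_(0 <= n < b) dchar f n) <= m%:R.
Proof.
move=> fD f0; have [N] := ubnP b; elim: N b => // N IH b bN.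
have [bm|mb] := ltnP b m.
  apply: le_trans (nrm_le_sum (G := fun=> 1) _) _; first by move=> i _ _; apply: nrm_dchar_le.
  by rewrite sumr_const_nat subn0 ler_nat ltnW.
rewrite (@big_cat_nat _ _ _ m) //= sum_dchar_period // add0r -{1}[m]add0n big_addn.
by under eq_bigr do rewrite dchar_per; apply: IH; lia.
Qed.

Lemma dchar_bounded f : f \in dual gT -> f != 0 ->
  bounded_char (2%:R * m%:R) (dchar f).
Proof.
move=> fD f0; split; [exact: dchar1|by move=> *; apply: dcharM|exact: nrm_dchar_le|].
move=> a b; have [ab|ba] := leqP a b; last first.
  by rewrite big_geq 1?ltnW // nrm0 mulr_ge0.
have -> : \sum_(a <= n < b) dchar f n = \sum_(0 <= n < b) dchar f n - \sum_(0 <= n < a) dchar f n.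
  by rewrite [X in X - _](@big_cat_nat _ _ _ a) //= addrAC subrr add0r.
apply: le_trans (nrmB _ _) _; rewrite mulrDl mul1r.
by apply: lerD; apply: dchar_sum_le.
Qed.

Lemma dcharN f n : dchar (- f) n = (dchar f n)^*.
Proof.
by rewrite /dchar; case: insubP => [u _ _|_]; rewrite ?(dvalN zetaP) ?conjc0.
Qed.

(** If f = - f then each value on a unit has square 1. *)
Lemma dchar_real f : f \in dual gT -> - f = f ->
  exists2 eps : nat -> R, dchar f =1 (fun n => (eps n)%:C)
    & forall n, eps n \in [:: -1; 0; 1].
Proof.
move=> fD ff; exists (fun n => complex.Re (dchar f n)) => n; last first.
  case: (boolP (coprime m n)) => mn; last by rewrite dchar_non // !inE eqxx orbT.
  have [u un] := residue_unit mn; rewrite (dchar_unit _ un).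
  have /eqP : dval zeta f u ^+ 2 = 1.
    by rewrite expr2 -(dvalD zetaP) -{1}ff addNr dval0.
  rewrite sqrf_eq1 !inE => /orP[]/eqP->.
    by have -> : complex.Re (1 : C) = 1 by []; rewrite eqxx !orbT.
  by have -> : complex.Re (- 1 : C) = - 1 by []; rewrite eqxx.
have := dcharN f n; rewrite ff; case: (dchar f n) => a b /= [h].
congr Complex; lra.
Qed.

(** This plays the role of L(1, chi) = 0, for chi the character of f. *)
Definition vanishing (f : hom) : Prop :=
  forall y, nrm (Lpartial (dchar f) y) <= 2%:R * m%:R / y.+1%:R.

Lemma real_not_vanishing f : f \in dual gT -> f != 0 -> - f = f -> ~ vanishing f.
Proof.
move=> fD f0 ff; have [eps epsE eps_val] := dchar_real fD ff.
move=> V; have := dchar_bounded fD f0; have : bounded_char (2%:R * m%:R) (fun n => (eps n)%:C).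
  have [h1 hM hle hs] := dchar_bounded fD f0.
  split=> [|a b|n|a b]; rewrite -?epsE //.
  by under eq_bigr do rewrite -epsE.
move=> bc _; apply: (real_char_nonvanishing bc eps_val) => y.
apply: le_trans (V y); rewrite /Lpartial /twist.
by under eq_bigr do rewrite -epsE.
Qed.

Definition eventually_le (h : nat -> R) := exists B Y, forall x, (Y <= x)%N -> h x <= B.

Lemma eventually_le_sum (I : eqType) (s : seq I) (h : I -> nat -> R) :
  (forall i, i \in s -> eventually_le (h i)) ->
  eventually_le (fun x => \sum_(i <- s) h i x).
Proof.
elim: s => [|i s IH] H.
  by exists 0, 0%N => x _; rewrite big_nil.
have [B [Y HB]] := H i (mem_head _ _).
have [|B' [Y' HB']] := IH; first by move=> j js; apply: H; rewrite inE js orbT.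
exists (B + B'), (maxn Y Y') => x; rewrite geq_max => /andP[Yx Yx'].
by rewrite big_cons lerD ?HB ?HB'.
Qed.

Definition residue_mertens (c x : nat) : R :=
  \sum_(1 <= n < x.+1 | n == c %[mod m]) mangoldt n / n%:R.

Definition coprime_mertens (x : nat) : R :=
  \sum_(1 <= n < x.+1 | coprime m n) mangoldt n / n%:R.

Lemma natr_eq_mod a b : (a%:R == b%:R :> 'Z_m) = (a == b %[mod m]).
Proof. by rewrite -val_eqE /= !val_Zp_nat. Qed.

(** Orthogonality: after exchanging the sums, the coefficient of Lambda(n)/n
    is the sum of the values of all characters at v^-1 u, where u is the class
    of n; it is zero unless u = v. *)
Lemma sum_dual_Lmangoldt c (v : gT) x : c%:R = val v :> 'Z_m ->
  \sum_(f in dual gT) dval zeta f v^-1%g * Lmangoldt (dchar f) x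
  = (#|dual gT|%:R * residue_mertens c x)%:C.
Proof.
move=> vc; have abG : abelian [set: gT] by apply: (units_Zp_abelian m).
have cm := residue_coprime vc.
rewrite /Lmangoldt; under eq_bigr do rewrite mulr_sumr.
rewrite exchange_big /= /residue_mertens [in RHS]big_mkcond [in RHS]mulr_sumr rmorph_sum /=.
apply: eq_bigr => n _.
transitivity ((mangoldt n / n%:R)%:C * \sum_(f in dual gT) (dval zeta f v^-1%g * dchar f n)).
  rewrite mulr_sumr; apply: eq_bigr => f _.
  by rewrite /twist rmorphM /=; ring.
case: (boolP (coprime m n)) => mn; last first.
  rewrite big1 ?mulr0 => [|f _]; last by rewrite dchar_non ?mulr0.
  case: eqP => nc; last by rewrite mulr0 rmorph0.
  by move: mn; rewrite -coprime_modr nc coprime_modr cm.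
have [u un] := residue_unit mn.
rewrite -natr_eq_mod un vc.
have -> : \sum_(f in dual gT) dval zeta f v^-1%g * dchar f n
    = \sum_(f in dual gT) dval zeta f (v^-1 * u)%g.
  by apply: eq_bigr => f fD; rewrite (dchar_unit _ un) -(dvalM zetaP).
rewrite (sum_dual zetaP) // -eq_mulVg1 (inj_eq val_inj) eq_sym.
case: eqP => _; last by rewrite muln0 !mulr0 rmorph0.
by rewrite muln1 !rmorphM rmorph_nat /= mulrC.
Qed.

Lemma Lmangoldt_trivial x : Lmangoldt (dchar 0) x = (coprime_mertens x)%:C.
Proof.
rewrite /Lmangoldt /coprime_mertens [X in X%:C]big_mkcond /= rmorph_sum; apply: eq_bigr => n _.
rewrite /twist; case: (boolP (coprime m n)) => mn.
  by have [u un] := residue_unit mn; rewrite (dchar_unit _ un) dval0 mul1r mulrC -rmorphM.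
by rewrite dchar_non // !mul0r rmorph0.
Qed.

Lemma coprime_mertens_le x : (0 < x)%N -> coprime_mertens x <= lg x + 8%:R.
Proof.
move=> x0; apply: le_trans (mertens_le x0).
rewrite /mertens (bigID (coprime m)) /= lerDl sumr_ge0 // => n _.
by rewrite divr_ge0 ?mangoldt_ge0.
Qed.

Lemma coprime_mertens_ge x : (0 < x)%N -> lg x - (3%:R + lgfact m) <= coprime_mertens x.
Proof.
move=> x0; have := mertens_ge x0; rewrite /mertens (bigID (coprime m)) /=.
have := @sum_noncoprime_mangoldt_le m x isT.
have -> : \sum_(1 <= n < x.+1 | ~~ coprime n m) mangoldt n / n%:R
  = \sum_(1 <= n < x.+1 | ~~ coprime m n) mangoldt n / n%:R :> R.
  by apply: eq_bigl => n; rewrite coprime_sym.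
rewrite -/(coprime_mertens x); move: (lgfact m) => F; lra.
Qed.

Lemma residue_mertens_ge0 c x : 0 <= residue_mertens c x.
Proof. by rewrite sumr_ge0 // => n _; rewrite divr_ge0 ?mangoldt_ge0. Qed.

Lemma Re_le_nrm (w : C) : complex.Re w <= nrm w.
Proof.
case: w => a b; rewrite /nrm /=; apply: le_trans (ler_norm a) _.
by rewrite -sqrtr_sqr ler_sqrt ?addr_ge0 ?sqr_ge0 // lerDl sqr_ge0.
Qed.

Lemma ReD (u w : C) : complex.Re (u + w) = complex.Re u + complex.Re w.
Proof. by case: u w => a b [c d]. Qed.

Lemma Re_sum (I : Type) (s : seq I) (Q : pred I) (F : I -> C) :
  complex.Re (\sum_(i <- s | Q i) F i) = \sum_(i <- s | Q i) complex.Re (F i).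
Proof.
elim/big_rec2: _ => [|i a b _ <-] //; exact: ReD. Qed.

Lemma vanishing_Re f x : f \in dual gT -> f != 0 -> vanishing f -> (0 < x)%N ->
  complex.Re (Lmangoldt (dchar f) x) <= 2%:R * m%:R - lg x.
Proof.
move=> fD f0 V x0; have h := Lmangoldt_vanishing (dchar_bounded fD f0) x0 V.
have := le_trans (Re_le_nrm _) h; rewrite ReD /=; lra.
Qed.

Lemma nonvanishing_nrm f : f \in dual gT -> f != 0 -> ~ vanishing f ->
  eventually_le (fun x => nrm (Lmangoldt (dchar f) x)).
Proof.
move=> fD f0 nV; have bc := dchar_bounded fD f0.
have [y Vy] : exists y, 2%:R * m%:R / y.+1%:R < nrm (Lpartial (dchar f) y).
  apply: boolp.contrapT => h; apply: nV => y; rewrite leNgt; apply/negP => hy.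
  by apply: h; exists y.
have [B HB] := Lmangoldt_nonvanishing bc Vy.
by exists B, y.+1 => x yx; apply: HB; [apply: leq_trans yx | apply: ltnW].
Qed.

Lemma Re_eventually_le f : f \in dual gT -> f != 0 ->
  eventually_le (fun x => complex.Re (Lmangoldt (dchar f) x)).
Proof.
move=> fD f0; have [V|nV] := boolp.pselect (vanishing f).
  exists (2%:R * m%:R), 1%N => x x0; apply: le_trans (vanishing_Re fD f0 V x0) _.
  by rewrite gerBl lg_ge0.
have [B [Y HB]] := nonvanishing_nrm fD f0 nV.
by exists B, Y => x Yx; apply: le_trans (Re_le_nrm _) (HB x Yx).
Qed.

(** If f vanishes and f != - f then - f vanishes as well, and both contribute
    - lg x + O(1) to the sum over all characters. The trivial one contributes
    lg x + O(1) and all others are bounded above, so the sum would tend to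
    minus infinity; but it is nonnegative. *)
Lemma not_vanishing f : f \in dual gT -> f != 0 -> ~ vanishing f.
Proof.
move=> fD f0 V; have [ff|ff] := eqVneq (- f) f; first exact: real_not_vanishing V.
have fDN := dualN fD; have f0N : - f != 0 by rewrite oppr_eq0.
have VN : vanishing (- f).
  move=> y; apply: le_trans (V y); rewrite le_eqVlt; apply/orP; left; apply/eqP.
  have -> : Lpartial (dchar (- f)) y = (Lpartial (dchar f) y)^*.
    rewrite /Lpartial rmorph_sum; apply: eq_bigr => n _.
    by rewrite /twist rmorphM /= dcharN oppr0.
  by case: (Lpartial _ _) => a b; rewrite /nrm /= sqrrN.
pose s := [seq g <- enum (dual gT) | [&& g != 0, g != f & g != - f]].
have [|B [Y HB]] := @eventually_le_sum _ s (fun g x => complex.Re (Lmangoldt (dchar g) x)).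
  by move=> g; rewrite mem_filter mem_enum => /andP[/and3P[g0 _ _] gD]; apply: Re_eventually_le.
have [N HN] := lg_unbounded (8%:R + 2%:R * (2%:R * m%:R) + B).
set x := maxn Y (maxn N 1).
have [Yx Nx x0] : [/\ (Y <= x)%N, (N <= x)%N & (0 < x)%N].
  by rewrite !leq_max !leqnn orbT !orbT.
have split_sum : \sum_(g in dual gT) complex.Re (Lmangoldt (dchar g) x)
  = complex.Re (Lmangoldt (dchar 0) x) + (complex.Re (Lmangoldt (dchar f) x)
    + (complex.Re (Lmangoldt (dchar (- f)) x) + \sum_(g <- s) complex.Re (Lmangoldt (dchar g) x))).
  rewrite (bigD1 (0 : hom)) ?dual0 //= (bigD1 f) ?fD ?f0 //= (bigD1 (- f)) ?fDN ?f0N ?ff //=.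
  do 3 congr (_ + _); rewrite /s big_filter big_enum_cond /=.
  by apply: eq_bigl => g; rewrite !andbA.
have := @sum_dual_Lmangoldt 1 1%g x erefl.
move/(congr1 (@complex.Re R)); rewrite Re_sum /=.
under eq_bigr => g gD do rewrite invg1 (dval1 zetaP) // mul1r.
rewrite split_sum Lmangoldt_trivial /= => tot.
have tot_ge0 : 0 <= #|dual gT|%:R * residue_mertens 1 x :> R.
  by rewrite mulr_ge0 ?residue_mertens_ge0.
have := coprime_mertens_le x0; have := vanishing_Re fD f0 V x0.
have := vanishing_Re fDN f0N VN x0; have := HB x Yx; have := HN x Nx.
move: tot_ge0; rewrite -tot.
move: (coprime_mertens x) (lg x) (2%:R * m%:R) (complex.Re _) (complex.Re _) (\sum_(_ <- _) _).
by clear=> a b c d e g; lra.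
Qed.

(** By sum_dual_Lmangoldt the second term is the trivial character's sum, of
    size lg x, plus the bounded sums of the nontrivial ones. *)
Lemma residue_mertens_ge c : coprime m c ->
  eventually_le (fun x => lg x - #|dual gT|%:R * residue_mertens c x).
Proof.
move=> mc; have [v vc] := residue_unit mc.
pose s := [seq g <- enum (dual gT) | g != 0].
have [|B [Y HB]] := @eventually_le_sum _ s (fun g x => nrm (Lmangoldt (dchar g) x)).
  move=> g; rewrite mem_filter mem_enum => /andP[g0 gD].
  exact: nonvanishing_nrm (not_vanishing gD g0).
exists (3%:R + lgfact m + B), (maxn Y 1) => x; rewrite geq_max => /andP[Yx x0].
have := sum_dual_Lmangoldt x vc; move/(congr1 (@complex.Re R)); rewrite Re_sum /=.
rewrite (bigD1 (0 : hom)) ?dual0 //= dval0 mul1r Lmangoldt_trivial /=.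
set r := \sum_(_ in _ | _) _ => tot.
have rB : - r <= B.
  apply: le_trans (HB x Yx); rewrite /s big_filter big_enum_cond /= /r -sumrN.
  apply: ler_sum => g _.
  have -> : nrm (Lmangoldt (dchar g) x) = nrm (- (dval zeta g v^-1%g * Lmangoldt (dchar g) x)).
    by rewrite nrmN nrmM (nrm_dval zetaP) mul1r.
  apply: le_trans (Re_le_nrm _).
  by case: (dval zeta g v^-1%g * Lmangoldt (dchar g) x).
have := coprime_mertens_ge x0; rewrite -tot.
move: rB; move: (coprime_mertens x) (lg x) (lgfact m) r {tot} => a b d e; lra.
Qed.

End DirichletChar.

Theorem dirichlet_primes (m c : nat) : (1 < m)%N -> coprime m c ->
  exists2 q, prime q & q = c %[mod m].
Proof.
case: m => [|[|m']] // _ mc.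
have e0 : (0 < #|({unit 'Z_m'.+2} : finGroupType)|.-1.+1)%N by [].
have [zeta zetaP] := closed_prim_root_exists C e0.
have [B [Y HB]] := residue_mertens_ge zetaP mc.
set D : R := #|dual _|%:R in HB.
have [N HN] := lg_unbounded (B + D * 2%:R).
apply: boolp.contrapT => no_prime.
set x := maxn Y (maxn N 1).
have Yx : (Y <= x)%N by rewrite leq_maxl.
have Nx : (N <= x)%N by rewrite !leq_max leqnn orbT.
have := HB x Yx; have := HN x Nx.
have : D * residue_mertens m' c x <= D * 2%:R.
  apply: ler_wpM2l; first exact: ler0n.
  apply: le_trans (sum_nonprime_mangoldt_le x).
  rewrite /residue_mertens big_mkcond [leRHS]big_mkcond /=; apply: ler_sum => n _.
  have pos : 0 <= mangoldt n / n%:R by rewrite divr_ge0 ?mangoldt_ge0.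
  case: eqP => [nc|_]; last by case: ifP.
  case: (boolP (prime n)) => //= pn; case: no_prime; exists n => //.
move: (D * _) (D * _) (lg x) => a b l; lra.
Qed.

(** * Prime representatives of the orbits of doubling *)

Local Open Scope nat_scope.

Lemma expn_mod_logd2 z L x : is_logd2_1 z L -> 2 ^ x = 2 ^ (x %% L) %[mod z].
Proof.
case=> _ L1 _; rewrite {1}(divn_eq x L) expnD [x %/ L * L]mulnC expnM.
by rewrite -modnMml -modnXm L1 modnXm exp1n modnMml mul1n.
Qed.

(** As 2 is invertible mod z, equality of two powers makes 2^(y-x) congruent
    to 1, so y - x is 0 or at least L. *)
Lemma expn2_mod_inj z L x y : odd z -> is_logd2_1 z L -> (x <= y)%N -> (y < L)%N ->
  2 ^ x = 2 ^ y %[mod z] -> x = y.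
Proof.
move=> zo [_ _ Lmin] xy yL /esym/eqP; rewrite eqn_mod_dvd ?leq_exp2l //.
rewrite -(subnK xy) expnD -{2}[2 ^ x]mul1n -mulnBl Gauss_dvdl; last first.
  by rewrite coprimeXr // coprimen2.
rewrite -eqn_mod_dvd ?expn_gt0 // => /eqP h.
case: (posnP (y - x)) => [|d0]; first by lia.
have := Lmin _ d0 h; lia.
Qed.

Lemma coprime_lift M i : (0 < M)%N -> coprime i M -> exists2 c, coprime c (2 * M) & c = i %[mod M].
Proof.
move=> M0 iM; case: (boolP (odd i)) => io.
  by exists i => //; rewrite coprimeMr iM coprimen2 io.
have Mo : odd M.
  apply: contraR io => Me; move: iM; rewrite -[M]odd_double_half (negbTE Me) add0n -mul2n.
  by rewrite coprimeMr coprimen2 => /andP[].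
exists (i + M); last by rewrite modnDr.
by rewrite coprimeMr coprimen2 oddD Mo (negbTE io) /= -coprime_modl modnDr coprime_modl.
Qed.

(** A unit mod M lifts to a unit mod 2M: i or i + M is odd when M is odd. A
    prime in the lifted class is then odd. *)
Lemma prime_lift M i : (0 < M)%N -> coprime i M ->
  exists q, [/\ prime q, odd q & q = i %[mod M]].
Proof.
move=> M0 iM; have [c cM ci] := coprime_lift M0 iM.
have [||q qp qc] := @dirichlet_primes (2 * M) c; [by lia|by rewrite coprime_sym|].
exists q; split=> //.
  rewrite -coprimen2; have : coprime q (2 * M) by rewrite -coprime_modl qc coprime_modl.
  by rewrite coprimeMr => /andP[].
by rewrite -ci -(modn_dvdm q (dvdn_mull 2 (dvdnn M))) qc modn_dvdm // dvdn_mull.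
Qed.

Section Classes.

Variables (z k L : nat).
Hypotheses (z_odd : odd z) (LP : is_logd2_1 z L).
Local Notation K := (2 ^ k).
Local Notation M := (z * K).

Lemma L_gt0 : (0 < L)%N. Proof. by case: LP. Qed.
Lemma z_gt0 : (0 < z)%N. Proof. exact: odd_gt0. Qed.
Lemma M_gt0 : (0 < M)%N. Proof. by rewrite muln_gt0 z_gt0 expn_gt0. Qed.
Lemma coprime_zK : coprime z K. Proof. by rewrite coprimeXr // coprimen2. Qed.

(** In the theorem g^(2^x a) changes with x in its part of order z, while the
    correcting power of m' keeps the part of 2-power order fixed; on exponents
    this is doubling modulo z alone. *)
Definition doubling_step (x i j : nat) : bool :=
  (j == 2 ^ x * i %[mod z]) && (j == i %[mod K]).

Definition doubling (i j : nat) : bool := [exists x : 'I_L, doubling_step x i j].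

Lemma doublingP i j : reflect (exists x, doubling_step x i j) (doubling i j).
Proof.
apply: (iffP existsP) => [[x h]|[x /andP[hz hK]]]; first by exists x.
exists (Ordinal (ltn_pmod x L_gt0)); rewrite /doubling_step hK andbT /=.
by rewrite (eqP hz) -modnMml (expn_mod_logd2 x LP) modnMml.
Qed.

Lemma doubling_refl i : doubling i i.
Proof. by apply/doublingP; exists 0; rewrite /doubling_step mul1n !eqxx. Qed.

Lemma doubling_trans i j l : doubling i j -> doubling j l -> doubling i l.
Proof.
move=> /doublingP[x /andP[/eqP hz /eqP hK]] /doublingP[y /andP[/eqP hz' /eqP hK']].
apply/doublingP; exists (y + x); rewrite /doubling_step hz' hK' hK eqxx andbT.
by rewrite expnD -mulnA -modnMmr hz modnMmr.
Qed.

Lemma doubling_sym i j : doubling i j -> doubling j i.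
Proof.
move=> /doublingP[x /andP[/eqP hz /eqP hK]]; apply/doublingP; exists (x * L.-1).
rewrite /doubling_step hK eqxx andbT -modnMmr hz modnMmr mulnA -expnD.
have -> : x * L.-1 + x = x * L by rewrite -mulnSr prednK ?L_gt0.
by rewrite -modnMml (expn_mod_logd2 _ LP) modnMl modnMml mul1n.
Qed.

Definition residues : {set 'I_M} := [set i : 'I_M | coprime i M].

Lemma card_residues : #|residues| = totient M.
Proof.
rewrite totient_count_coprime big_mkord -sum1_card big_mkcond /=.
by apply: eq_bigr => i _; rewrite inE coprime_sym; case: coprime.
Qed.

Definition class_partition : {set {set 'I_M}} :=
  equivalence_partition (fun i j : 'I_M => doubling i j) residues.

Lemma doubling_equiv :
  {in residues & &, equivalence_rel (fun i j : 'I_M => doubling i j)}.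
Proof.
move=> i j l _ _ _; split=> [|ij]; first exact: doubling_refl.
by apply/idP/idP; apply: doubling_trans => //; apply: doubling_sym.
Qed.

Lemma class_partitionP : partition class_partition residues.
Proof. exact: equivalence_partitionP doubling_equiv. Qed.

Lemma mem_class B i j : B \in class_partition -> i \in B ->
  (j \in B) = (j \in residues) && doubling i j.
Proof.
move=> BP iB; have /and3P[/eqP cov tri _] := class_partitionP.
have iT : i \in residues by rewrite -cov; apply/bigcupP; exists B.
rewrite -(def_pblock tri BP iB); apply/idP/andP => [jB|[jT]].
  have jT : j \in residues.
    by rewrite -cov; apply/bigcupP; exists B => //; rewrite -(def_pblock tri BP iB).
  by rewrite -(pblock_equivalence_partition doubling_equiv).
by rewrite (pblock_equivalence_partition doubling_equiv).
Qed.

Lemma class_inhab B : B \in class_partition -> exists2 i, i \in B & i \in residues.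
Proof.
move=> BP; have /and3P[/eqP cov tri n0] := class_partitionP.
have /set0Pn[i iB] : B != set0 by apply: contra n0 => /eqP<-.
by exists i => //; rewrite -cov; apply/bigcupP; exists B.
Qed.

(** The orbit of i is parametrised by x < L through the Chinese remainder
    theorem, injectively because i is invertible mod z. *)
Lemma card_class B : B \in class_partition -> #|B| = L.
Proof.
move=> BP; have [i iB iT] := class_inhab BP.
pose f (x : 'I_L) : 'I_M := Ordinal (ltn_pmod (chinese z K (2 ^ x * i) i) M_gt0).
have fz x : f x = 2 ^ x * i %[mod z].
  by rewrite /= modn_dvdm ?dvdn_mulr // chinese_modl // coprime_zK.
have fK x : f x = i %[mod K].
  by rewrite /= modn_dvdm ?dvdn_mull // chinese_modr // coprime_zK.
have iM : coprime i M by move: iT; rewrite inE.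
have [iz iK] : coprime i z /\ coprime i K by apply/andP; rewrite -coprimeMr.
have -> : B = f @: setT.
  apply/setP => j; rewrite (mem_class j BP iB); apply/andP/imsetP.
    move=> [_ /existsP[x /andP[/eqP jz /eqP jK]]]; exists x => //.
    apply/val_inj/eqP; rewrite -[val j](modn_small (ltn_ord j)).
    rewrite -[val (f x)](modn_small (ltn_ord (f x))) chinese_remainder ?coprime_zK //.
    by rewrite jz jK fz fK !eqxx.
  move=> [x _ ->]; split; last by apply/existsP; exists x; rewrite /doubling_step fz fK !eqxx.
  rewrite inE coprimeMr -coprime_modl fz coprime_modl coprimeMl iz andbT.
  by rewrite -[coprime (f x) K]coprime_modl fK coprime_modl iK andbT coprimeXl // coprime2n.
rewrite card_imset ?cardsT ?card_ord // => x y xy.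
have E : 2 ^ x = 2 ^ y %[mod z].
  have := fz y; rewrite -xy fz => /eqP h; apply/eqP; move: h.
  wlog le : x y {xy} / x <= y.
    by move=> W; case: (leqP x y) => [|/ltnW] h; [exact: W|rewrite eq_sym => /(W _ _ h); rewrite eq_sym].
  rewrite eq_sym eqn_mod_dvd ?leq_mul2r ?leq_exp2l ?le ?orbT //.
  by rewrite -mulnBl Gauss_dvdl 1?coprime_sym // -eqn_mod_dvd ?leq_exp2l // eq_sym.
apply/val_inj; case: (leqP x y) => h.
  exact: (expn2_mod_inj z_odd LP h (ltn_ord y) E).
by symmetry; apply: (expn2_mod_inj z_odd LP (ltnW h) (ltn_ord x)).
Qed.

(** There are totient M / L classes. The class of 1 needs no prime, so
    choosing one in each other class leaves one prime short of the stated
    size, and any prime larger than 2, than z and than all those chosen fills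
    the gap. *)
Lemma prime_representatives : exists A : seq nat,
  [/\ uniq A, size A = totient M %/ L,
      {in A, forall a, [/\ prime a, odd a & coprime a z]}
    & forall i, coprime i M ->
      exists2 a, a \in 1 :: A & exists2 x, x < L & doubling_step x a i].
Proof.
have /and3P[/eqP cov tri n0] := class_partitionP.
have cP : totient M = #|class_partition| * L.
  by rewrite -card_residues; apply: card_uniform_partition class_partitionP; exact: card_class.
pose represents (B : {set 'I_M}) (a : nat) := B \in class_partition ->
    [/\ prime a, odd a, coprime a z & exists2 i : 'I_M, i \in B & a = i %[mod M]].
have [|q qP] := @boolp.choice _ _ represents.
  move=> B; case: (boolP (B \in class_partition)) => BP; last first.
    by exists 0 => h; rewrite h in BP.
  have [i iB iT] := class_inhab BP; rewrite inE in iT.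
  have [p [pp po pi]] := prime_lift M_gt0 iT.
  exists p => _; split=> //; last by exists i.
  have : coprime p M by rewrite -coprime_modl pi coprime_modl.
  by rewrite coprimeMr => /andP[].
have one_r : Ordinal (ltn_pmod 1 M_gt0) \in residues.
  by rewrite inE /= coprime_modl coprime1n.
set one := Ordinal _ in one_r.
pose B1 := pblock class_partition one.
have B1P : B1 \in class_partition by rewrite pblock_mem // cov.
have oneB1 : one \in B1 by rewrite mem_pblock cov.
pose Q := [seq q B | B <- enum (class_partition :\ B1)].
(* The prime that fills the gap; being larger than 2 and z, it is odd and
   prime to z. *)
have [e e_gt ep] := prime_above (maxn (maxn 2 z) (\max_(a <- Q) a)).
have e2 : 2 < e by lia.
have ez : z < e by lia.
have eQ : e \notin Q.
  apply/negP => eQ; have : e <= \max_(a <- Q) a by apply: leq_bigmax_seq.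
  lia.
exists (e :: Q); split.
- rewrite /= eQ map_inj_in_uniq ?enum_uniq // => B B'; rewrite !mem_enum !inE.
  move=> /andP[_ BP] /andP[_ BP'] qq.
  have [_ _ _ [i iB qi]] := qP B BP; have [_ _ _ [j jB qj]] := qP B' BP'.
  have ij : i = j.
    apply/val_inj; rewrite /= -(modn_small (ltn_ord i)) -(modn_small (ltn_ord j)).
    by rewrite -qi -qj qq.
  by rewrite -(def_pblock tri BP iB) -(def_pblock tri BP' jB) ij.
- rewrite /= size_map -cardE cP mulnK ?L_gt0 //.
  by rewrite [RHS](cardsD1 B1) B1P.
- move=> a; rewrite inE => /orP[/eqP->|/mapP[B]].
    have eo : odd e by case/even_prime: ep => // h; move: e2; rewrite h.
    split=> //; rewrite prime_coprime //; apply/negP => /(dvdn_leq z_gt0); lia.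
  by rewrite mem_enum inE => /andP[_ /qP[? ? ? _]] ->.
move=> i iM; pose i' : 'I_M := Ordinal (ltn_pmod i M_gt0).
have i'T : i' \in residues by rewrite inE /= coprime_modl.
pose B := pblock class_partition i'.
have BP : B \in class_partition by rewrite pblock_mem // cov.
have i'B : i' \in B by rewrite mem_pblock cov.
have lift (j : 'I_M) a : j \in B -> a = j %[mod M] ->
    exists2 x, x < L & doubling_step x a i.
  move=> jB aj; have := mem_class i' BP jB; rewrite i'B => /esym/andP[_ /existsP[x]].
  have zM : z %| M by apply: dvdn_mulr.
  have KM : K %| M by apply: dvdn_mull.
  rewrite /doubling_step /= (modn_dvdm _ zM) (modn_dvdm _ KM) => /andP[/eqP h1 /eqP h2].
  have az : a = j %[mod z] by rewrite -(modn_dvdm a zM) aj modn_dvdm.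
  have aK : a = j %[mod K] by rewrite -(modn_dvdm a KM) aj modn_dvdm.
  by exists x => //; rewrite h1 h2 aK -modnMmr -az modnMmr !eqxx.
case: (eqVneq B B1) => [BB|BB].
  exists 1; first exact: mem_head.
  by apply: (lift one); rewrite ?BB //= modn_mod.
have [_ _ _ [j jB qj]] := qP B BP.
exists (q B); last exact: lift jB qj.
by rewrite !inE map_f ?orbT // mem_enum !inE BB.
Qed.

End Classes.

(** * Primitive and semi-primitive roots *)

Local Open Scope ring_scope.

Lemma unit_prim_root (F : finFieldType) (u : {unit F}) :
  #[u]%g.-primitive_root (val u).
Proof.
have valX i : val (u ^+ i)%g = val u ^+ i by rewrite FinRing.val_unitX.
have [|d dP du] := @prim_order_exists _ #[u]%g (val u) (order_gt0 u).
  by rewrite -valX expg_order.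
suff <- : d = #[u]%g by [].
apply/eqP; rewrite eqn_dvd du order_dvdn -val_eqE /= valX.
by rewrite (prim_expr_order dP).
Qed.

Lemma prim_root_order_inj (F : fieldType) (x : F) a b :
  a.-primitive_root x -> b.-primitive_root x -> a = b.
Proof.
move=> aP bP; apply/eqP; rewrite eqn_dvd (prim_order_dvd aP) (prim_order_dvd bP).
by rewrite (prim_expr_order aP) (prim_expr_order bP) !eqxx.
Qed.

Lemma sqr_prim_root (F : fieldType) (x : F) M :
  (2 * M).-primitive_root x -> M.-primitive_root (x ^+ 2).
Proof.
move=> xP; have := exp_prim_root xP 2; rewrite (_ : gcdn 2 (2 * M) = 2) ?mulKn //.
by apply/gcdn_idPl; rewrite dvdn_mulr.
Qed.

Section Fp.

Variable p : nat.
Hypothesis p_prime : prime p.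

Lemma primitive_rootsP (x : 'F_p) : (x \in primitive_roots p) = (p - 1).-primitive_root x.
Proof.
have card : #|[set: {unit 'F_p}]| = (p - 1)%N.
  by rewrite card_finField_unit card_Fp // subn1.
apply/imsetP/idP => [[u]|xP].
  rewrite inE => /eqP gen ->; rewrite -card gen; exact: unit_prim_root.
have xu : x \is a GRing.unit.
  rewrite unitfE; apply/eqP => x0; have := prim_expr_order xP.
  have := prime_gt1 p_prime => p1; rewrite x0 expr0n.
  by rewrite subn_eq0 leqNgt p1 => /eqP; rewrite eq_sym oner_eq0.
exists (FinRing.unit _ xu) => //; rewrite inE.
have := prim_root_order_inj xP (unit_prim_root (FinRing.unit _ xu)) => ord.
by rewrite /generator eq_sym eqEcard subsetT /= card ord.
Qed.

Lemma exists_primitive_root : exists r : 'F_p, (p - 1).-primitive_root r.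
Proof.
have [u] := cyclicP (field_unit_group_cyclic [set: {unit 'F_p}]) => gen.
by exists (val u); rewrite -primitive_rootsP; apply: imset_f; rewrite inE; apply/eqP.
Qed.

(** Conversely, if x = (r^2)^i with i prime to M, the exponent i can be
    changed modulo M to one that is also odd, and x is then the square of a
    primitive root. *)
Lemma semi_primitive_rootsP (M : nat) (x : 'F_p) : (p - 1 = 2 * M)%N ->
  (x \in semi_primitive_roots p) = M.-primitive_root x.
Proof.
move=> pM; have p1 := prime_gt1 p_prime; have M0 : (0 < M)%N by lia.
apply/imsetP/idP => [[y]|xP].
  by rewrite primitive_rootsP pM => yP ->; apply: sqr_prim_root.
have [r rP] := exists_primitive_root; rewrite pM in rP.
have r2 : M.-primitive_root (r ^+ 2) by apply: sqr_prim_root.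
have [i xE] := prim_rootP r2 (prim_expr_order xP).
have iM : coprime i M by rewrite -(prim_root_exp_coprime _ r2) -xE.
have [c cM ci] := coprime_lift M0 iM.
exists (r ^+ c); first by rewrite primitive_rootsP pM prim_root_exp_coprime.
by rewrite exprAC xE; apply/eqP; rewrite (eq_prim_root_expr r2) ci.
Qed.

Lemma iter_sqrt1P k (x : 'F_p) : (x \in iter_sqrt1 p k) = (x ^+ (2 ^ k) == 1).
Proof.
elim: k x => [|k IH] x; first by rewrite inE expr1.
rewrite inE IH -exprM -expnS; apply: andb_idl => /eqP h.
by apply/unitrPr; exists (x ^+ (2 ^ k.+1).-1); rewrite -exprS prednK ?expn_gt0.
Qed.

Lemma exact_order_pow2 n (x : 'F_p) :
  x \in iter_sqrt1 p n.+1 :\: iter_sqrt1 p n -> (2 ^ n.+1).-primitive_root x.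
Proof.
rewrite inE !iter_sqrt1P => /andP[xn /eqP xS].
have [|d dP] := prim_order_exists _ xS; first by rewrite expn_gt0.
case/(dvdn_pfactor _ _ (isT : prime 2)) => j jn dE.
move: jn; rewrite leq_eqVlt => /orP[/eqP jn|jn]; first by rewrite -jn -dE.
by move: xn; rewrite -(prim_order_dvd dP) dE dvdn_exp2l.
Qed.

End Fp.

Section TwoParts.

Variables (F : fieldType) (z K : nat) (G t : F).
Hypotheses (zK : coprime z K) (GP : z.-primitive_root G) (tP : K.-primitive_root t).

(** Raising G t to the power d K, where d is its order, kills t, so z divides
    d K and hence d; similarly for K. *)
Lemma mul_prim_root : (z * K).-primitive_root (G * t).
Proof.
have z0 := prim_order_gt0 GP; have K0 := prim_order_gt0 tP.
have wN : (G * t) ^+ (z * K) = 1.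
  by rewrite exprMn {1}exprM (prim_expr_order GP) mulnC exprM (prim_expr_order tP) !expr1n mulr1.
have [|d dP dzK] := prim_order_exists _ wN; first by rewrite muln_gt0 z0.
suff <- : d = (z * K)%N by [].
apply/eqP; rewrite eqn_dvd dzK /= Gauss_dvd //; apply/andP; split.
  rewrite -(Gauss_dvdl d zK) (prim_order_dvd GP).
  have : (G * t) ^+ (d * K) = 1 by rewrite exprM (prim_expr_order dP) expr1n.
  by rewrite exprMn [in t ^+ _]mulnC [t ^+ _]exprM (prim_expr_order tP) expr1n mulr1 => ->.
rewrite -(@Gauss_dvdl K d z) 1?coprime_sym // (prim_order_dvd tP).
have : (G * t) ^+ (d * z) = 1 by rewrite exprM (prim_expr_order dP) expr1n.
by rewrite exprMn [in G ^+ _]mulnC [G ^+ _]exprM (prim_expr_order GP) expr1n mul1r => ->.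
Qed.

Lemma prim_root_of_parts u v : coprime u z -> coprime v K ->
  (z * K).-primitive_root (G ^+ u * t ^+ v).
Proof.
move=> uz vK; pose i := chinese z K u v.
have iz : i = u %[mod z] by apply: chinese_modl.
have iK : i = v %[mod K] by apply: chinese_modr.
have -> : G ^+ u * t ^+ v = (G * t) ^+ i.
  rewrite exprMn; congr (_ * _); apply/eqP.
    by rewrite (eq_prim_root_expr GP) iz.
  by rewrite (eq_prim_root_expr tP) iK.
rewrite (prim_root_exp_coprime _ mul_prim_root) coprimeMr.
by rewrite -coprime_modl iz coprime_modl uz -coprime_modl iK coprime_modl.
Qed.

(** Every primitive root of order z K is a power of G t with exponent i prime
    to z K; both parts then carry the same exponent. *)
Lemma parts_of_prim_root y : (z * K).-primitive_root y ->
  exists2 i, coprime i (z * K) & y = G ^+ i * t ^+ i.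
Proof.
move=> yP; have [i yE] := prim_rootP mul_prim_root (prim_expr_order yP).
exists i; last by rewrite yE exprMn.
by rewrite -(prim_root_exp_coprime _ mul_prim_root) -yE.
Qed.

End TwoParts.

Lemma exponent_of_3mod4 p z k :
  (p - 1 = z * 2 ^ k.+1)%N -> (p = 3 %[mod 4])%N -> k = 0%N.
Proof.
case: k => // k; rewrite !expnS => pE p4; exfalso.
by move: pE p4; move: (2 ^ k)%N => q; rewrite mulnCA (mulnCA z) mulnA => /=; lia.
Qed.

Lemma exponent_of_1mod4 p z k : odd z ->
  (p - 1 = z * 2 ^ k.+1)%N -> (p = 1 %[mod 4])%N -> (0 < k)%N.
Proof. by case: k => // z_odd; rewrite expn1; lia. Qed.

(** * Description of the semi-primitive and primitive roots *)

Theorem proposition2p2p11 (p n z L : nat) (g m' : 'F_p)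
    (p_prime : prime p) (p_odd : odd p)
    (p1E : (p - 1 = 2 ^ n * z)%N) (z_odd : odd z)
    (gS : g \in semi_primitive_roots p)
    (m'R : m' \in iter_sqrt1 p n :\: iter_sqrt1 p (n - 1))
    (gm' : g ^+ z * m' ^+ (2 * z) = 1)
    (LE : is_logd2_1 z L) :
  exists A : seq nat,
    [/\ uniq A,
        size A = (totient ((p - 1) %/ 2) %/ L)%N,
        {in A, forall a : nat, [/\ prime a, odd a & coprime a z]},
        semi_primitive_roots p =i
          [seq g ^+ (2 ^ x * a)%N * m' ^+ ((2 ^ x.+1 - 2) * a)%N
             | a <- 1%N :: A, x <- iota 0 L]
      & ((p = 3 %[mod 4])%N ->
          primitive_roots p =i
            [seq g ^+ (2 ^ x * a)%N * m' ^+ ((2 ^ x.+1 - 1) * a)%N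
               | a <- 1%N :: A, x <- iota 0 L])
        /\
        ((p = 1 %[mod 4])%N ->
          primitive_roots p =i
            [seq g ^+ (2 ^ x * a)%N * m' ^+ ((2 ^ x.+1 - 1) * a)%N
               | a <- 1%N :: A, x <- iota 0 L] ++
            [seq - (g ^+ (2 ^ x * a)%N * m' ^+ ((2 ^ x.+1 - 1) * a)%N)
               | a <- 1%N :: A, x <- iota 0 L])].
Proof.
have p1 := prime_gt1 p_prime.
case: n p1E m'R => [|k] p1E m'R.
  by exfalso; move: p_odd z_odd; rewrite mul1n in p1E; rewrite -p1E oddB ?(ltnW p1) // => ->.
rewrite subn1 /= in m'R.
pose M := (z * 2 ^ k)%N.
have pM : (p - 1 = 2 * M)%N by rewrite p1E /M expnS -mulnA (mulnC z).
have pN : (p - 1 = z * 2 ^ k.+1)%N by rewrite p1E mulnC.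
have z0 : (0 < z)%N := odd_gt0 z_odd.
have zK l : coprime z (2 ^ l) by rewrite coprimeXr // coprimen2.
have gP : M.-primitive_root g by rewrite -(semi_primitive_rootsP p_prime _ pM).
have mP := exact_order_pow2 m'R.
have m0 : m' != 0 by rewrite (prim_root_eq0 mP) expn_eq0.
pose t := m'^-1.
have tP : (2 ^ k.+1).-primitive_root t.
  have -> : t = m' ^+ (2 ^ k.+1).-1.
    by apply: (mulfI m0); rewrite divff // -exprS prednK ?expn_gt0 // (prim_expr_order mP).
  by rewrite (prim_root_exp_coprime _ mP) coprime_sym coprimenP ?expn_gt0.
have t2P : (2 ^ k).-primitive_root (t ^+ 2) by apply: sqr_prim_root; rewrite -expnS.
pose G := g * m' ^+ 2.
have gE : g = G * t ^+ 2 by rewrite /G exprVn mulfK // expf_neq0.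
have Gz : G ^+ z = 1 by rewrite exprMn -exprM.
have GP : z.-primitive_root G.
  have [d dP dz] := prim_order_exists z0 Gz.
  suff <- : d = z by [].
  apply/eqP; rewrite eqn_dvd dz /= -(@dvdn_pmul2r (2 ^ k)) ?expn_gt0 //.
  rewrite (prim_order_dvd gP) gE exprMn exprM (prim_expr_order dP) expr1n mul1r.
  by rewrite mulnC exprM (prim_expr_order t2P) expr1n.
(* The power of m' in the theorem cancels all of t^(2^(x+1) a) except t^(c a),
   with c = 2 for semi-primitive and c = 1 for primitive roots. *)
have tm e f : t ^+ (e + f) * m' ^+ f = t ^+ e.
  by rewrite exprD -mulrA -exprMn mulVf // expr1n mulr1.
have elem c x a : (c <= 2 ^ x.+1)%N ->
    g ^+ (2 ^ x * a)%N * m' ^+ ((2 ^ x.+1 - c) * a)%N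
    = G ^+ (2 ^ x * a)%N * t ^+ (c * a)%N.
  move=> cx; rewrite gE exprMn -mulrA -exprM mulnA -expnS.
  by rewrite -{1}(subnKC cx) mulnDl tm.
have [A [uA sA AP Arep]] := prime_representatives k z_odd LE.
have AP1 a : a \in 1%N :: A -> odd a /\ coprime a z.
  by rewrite inE => /orP[/eqP->|/AP[]//]; rewrite coprime1n.
have elem_step i x a : doubling_step z k x a i ->
    G ^+ i = G ^+ (2 ^ x * a)%N /\ (t ^+ i) ^+ 2 = (t ^+ a) ^+ 2.
  move=> /andP[/eqP iz /eqP iK]; split; apply/eqP.
    by rewrite (eq_prim_root_expr GP) iz.
  by rewrite -!exprM mulnC [(a * 2)%N]mulnC !exprM (eq_prim_root_expr t2P) iK.
have rep_prim y : y \in primitive_roots p ->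
    exists a x i, [/\ a \in 1%N :: A, (x < L)%N, odd i,
      y = G ^+ (2 ^ x * a)%N * t ^+ i & (t ^+ i) ^+ 2 = (t ^+ a) ^+ 2].
  rewrite primitive_rootsP // pN => yP.
  have [i iN yE] := parts_of_prim_root (zK k.+1) GP tP yP.
  have [iz io] : coprime i z /\ odd i.
    by move: iN; rewrite coprimeMr coprime_pexpr // coprimen2 => /andP[].
  have [|a aA [x xL st]] := Arep i.
    by rewrite coprimeMr iz coprimeXr // coprimen2.
  have [GE tE] := elem_step _ _ _ st.
  by exists a, x, i; split=> //; rewrite yE GE.
have prim_rep a x v : a \in 1%N :: A -> odd v -> G ^+ (2 ^ x * a)%N * t ^+ v \in primitive_roots p.
  move=> /AP1[ao az] vo; rewrite primitive_rootsP // pN.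
  apply: prim_root_of_parts => //; last by rewrite coprimeXr // coprimen2.
  by rewrite coprimeMl az andbT coprimeXl // coprime2n.
exists A; split=> //.
- by rewrite sA pM mulKn.
- move=> y; rewrite (semi_primitive_rootsP p_prime _ pM); apply/idP/allpairsP => [yP|].
    have [i iM yE] := parts_of_prim_root (zK k) GP t2P yP.
    have [a aA [x xL st]] := Arep i iM.
    exists (a, x); split; rewrite ?mem_iota //= elem; last first.
      by rewrite expnS leq_pmulr // expn_gt0.
    have [GE tE] := elem_step _ _ _ st.
    by rewrite yE GE; congr (_ * _); rewrite exprAC tE -exprM mulnC.
  move=> [[a x] /= [aA _ ->]]; rewrite elem; last by rewrite expnS leq_pmulr // expn_gt0.
  have [ao az] := AP1 a aA; rewrite [t ^+ _]exprM; apply: prim_root_of_parts => //.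
    by rewrite coprimeMl az andbT coprimeXl // coprime2n.
  by rewrite coprimeXr // coprimen2.
split=> p4.
- have k0 := exponent_of_3mod4 pN p4.
  move=> y; apply/idP/allpairsP => [/rep_prim[a [x [i [aA xL io yE _]]]]|].
    exists (a, x); split; rewrite ?mem_iota //= elem ?expn_gt0 // mul1n yE; congr (_ * _).
    apply/eqP; rewrite (eq_prim_root_expr tP) k0 expn1 !modn2 io.
    by have [->] := AP1 a aA.
  move=> [[a x] /= [aA _ ->]]; rewrite elem ?expn_gt0 // mul1n; apply: prim_rep => //.
  by have [] := AP1 a aA.
- have k0 := exponent_of_1mod4 z_odd pN p4.
  (* The element of order 2 in the cyclic group generated by t. *)
  have neg1 : -1 = t ^+ (2 ^ k) :> 'F_p.
    have : (t ^+ (2 ^ k)) ^+ 2 == 1 by rewrite -exprM -expnSr (prim_expr_order tP).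
    rewrite sqrf_eq1 -(prim_order_dvd tP) => /orP[|/eqP->//].
    by rewrite dvdn_Pexp2l // ltnn.
  move=> y; rewrite mem_cat; apply/idP/orP => [/rep_prim[a [x [i [aA xL io yE]]]]|].
    move/eqP; rewrite eqf_sqr => /orP[]/eqP tE; [left|right]; apply/allpairsP;
      exists (a, x); split; rewrite ?mem_iota //= elem ?expn_gt0 // mul1n yE tE //.
    by rewrite mulrN.
  case=> /allpairsP[[a x] /= [aA _ ->]]; rewrite elem ?expn_gt0 // mul1n.
    by apply: prim_rep => //; have [] := AP1 a aA.
  rewrite -mulrN -mulN1r neg1 -exprD; apply: prim_rep => //.
  by rewrite oddD oddX orbF (gtn_eqF k0) /=; have [] := AP1 a aA.
Qed.
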